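(* Let $\pi\colon\mathbb{L}(\mathbf{p})\to\mathbb{L}(\mathbf{q})$ be an admissible homomorphism with $\ker\pi\ne 0$, where $\mathbf{p}$ and $\mathbf{q}$ are both of domestic type or both of tubular type. Then, up to permutation of the entries of $\mathbf{p}$ (with the generators $\vec{x}_i$) and of the entries of $\mathbf{q}$ (with the generators $\vec{z}_j$), the data $\mathbf{p}$, $\mathbf{q}$, $\ker\pi$ and $\pi(\vec{x}_1,\vec{x}_2,\dots,\vec{x}_t):=(\pi(\vec{x}_1),\dots,\pi(\vec{x}_t))$ form one of the rows in the following lists; conversely, each row defines an admissible homomorphism with the indicated kernel. Each row is written as $\mathbf{p}\to\mathbf{q}$; $\ker\pi$; $\pi(\vec{x}_1,\dots,\vec{x}_t)$. Domestic types: (D1) $(2,3,4)\to(2,3,3)$; $\langle\vec{x}_1-2\vec{x}_3\rangle$; $(\vec{d},\ \vec{z}_2+\vec{z}_3,\ \vec{z}_1)$. (D2) $(2,3,3)\to(2,2,2)$; $\langle\vec{x}_2-\vec{x}_3\rangle$; $(\vec{z}_1+\vec{z}_2+\vec{z}_3,\ \vec{d},\ \vec{d})$. (D3) $(2,2,2p_3)\to(2,2,p_3)$; $\langle\vec{x}_2-p_3\vec{x}_3\rangle$; $(\vec{z}_1+\vec{z}_2,\ \vec{d},\ \vec{z}_3)$, with $p_3\ge1$. (D4) $(2,2,2p_3)\to(p_3,p_3)$; $\langle\vec{x}_1-\vec{x}_2,\ \vec{x}_1-p_3\vec{x}_3\rangle$; $(2\vec{d},\ 2\vec{d},\ \vec{z}_1+\vec{z}_2)$,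 with $p_3\ge1$. (D5) $(2,2,p_3)\to(p_3,p_3)$; $\langle\vec{x}_1-\vec{x}_2\rangle$; $(\vec{d},\ \vec{d},\ \vec{z}_1+\vec{z}_2)$, with $p_3\ge2$. (D6) $(nq_1,nq_2)\to(q_1,q_2)$; $\langle q_1\vec{x}_1-q_2\vec{x}_2\rangle$; $(\vec{z}_1,\ \vec{z}_2)$, with $n,q_1,q_2\ge2$. (D7) $(nq,n)\to(q)$; $\langle q\vec{x}_1-\vec{x}_2\rangle$; $(\vec{z}_1,\ \vec{d})$, with $n,q\ge2$. (D8) $(n,n)\to()$; $\langle\vec{x}_1-\vec{x}_2\rangle$; $(\vec{d},\ \vec{d})$, with $n\ge2$. Tubular types: (T1) $(2,2,2,2)\to(2,2,2,2)$; $\langle\vec{x}_1-\vec{x}_2\rangle$; $(\vec{d},\ \vec{d},\ \vec{z}_1+\vec{z}_2,\ \vec{z}_3+\vec{z}_4)$. (T2) $(2,2,2,2)\to(2,2,2,2)$; $\langle\vec{x}_1-\vec{x}_2,\ \vec{x}_1-\vec{x}_3\rangle$; $(2\vec{d},\ 2\vec{d},\ 2\vec{d},\ \vec{z}_1+\vec{z}_2+\vec{z}_3+\vec{z}_4)$. (T3) $(4,4,2)\to(4,4,2)$; $\langle2\vec{x}_1-\vec{x}_3\rangle$; $(\vec{z}_3,\ \vec{z}_1+\vec{z}_2,\ \vec{d})$. (T4) $(4,4,2)\to(2,2,2,2)$; $\langle\vec{x}_1-\vec{x}_2\rangle$; $(\vec{d},\ \vec{d},\ \vec{z}_1+\vec{z}_2+\vec{z}_3+\vec{z}_4)$.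 (T5) $(4,4,2)\to(2,2,2,2)$; $\langle2\vec{x}_1-2\vec{x}_2\rangle$; $(\vec{z}_1,\ \vec{z}_2,\ \vec{z}_3+\vec{z}_4)$. (T6) $(4,4,2)\to(2,2,2,2)$; $\langle2\vec{x}_1-2\vec{x}_2,\ 2\vec{x}_1-\vec{x}_3\rangle$; $(\vec{z}_1+\vec{z}_2,\ \vec{z}_3+\vec{z}_4,\ 2\vec{d})$. (T7) $(3,3,3)\to(3,3,3)$; $\langle\vec{x}_1-\vec{x}_2\rangle$; $(\vec{d},\ \vec{d},\ \vec{z}_1+\vec{z}_2+\vec{z}_3)$. (T8) $(6,3,2)\to(3,3,3)$; $\langle3\vec{x}_1-\vec{x}_3\rangle$; $(\vec{z}_1,\ \vec{z}_2+\vec{z}_3,\ \vec{d})$. (T9) $(6,3,2)\to(2,2,2,2)$; $\langle2\vec{x}_1-\vec{x}_2\rangle$; $(\vec{z}_1,\ \vec{d},\ \vec{z}_2+\vec{z}_3+\vec{z}_4)$.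
   Context: A weight sequence is a finite sequence $\mathbf{p}=(p_1,\dots,p_t)$, $t\ge0$, of integers $p_i\ge2$. The string group $\mathbb{L}(\mathbf{p})$ is the abelian group on generators $\vec{x}_1,\dots,\vec{x}_t$ with relations $p_1\vec{x}_1=\cdots=p_t\vec{x}_t=:\vec{c}$ (for $t=0$, $\mathbb{L}(())=\mathbb{Z}\vec{c}$ is infinite cyclic). For $\mathbf{q}=(q_1,\dots,q_s)$ the generators of $\mathbb{L}(\mathbf{q})$ are denoted $\vec{z}_1,\dots,\vec{z}_s$ and the canonical element $q_j\vec{z}_j=:\vec{d}$. Entries equal to $1$ in a sequence may be added or dropped without changing the string group; a generator of weight $1$ is equal to the canonical element (so for $p_3=1$ in (D3), $(2,2,p_3)$ means $(2,2)$ and $\vec{z}_3=\vec{d}$; for $p_3=1$ in (D4), $(p_3,p_3)$ means $()$ and $\vec{z}_1=\vec{z}_2=\vec{d}$). Each $\vec{x}\in\mathbb{L}(\mathbf{p})$ has a unique normal form $\vec{x}=\sum_i l_i\vec{x}_i+l\vec{c}$ with $0\le l_i\le p_i-1$, $l\in\mathbb{Z}$; set $\mathrm{mult}(\vec{x})=\max\{l+1,0\}$. Let $\mathrm{pr}_i\colon\mathbb{L}(\mathbf{p})\to\mathbb{Z}/p_i\mathbb{Z}$ be the homomorphism with $\mathrm{pr}_i(\vec{x}_j)=\delta_{ij}\bar1$. An infinite subgroup $G\subseteq\mathbb{L}(\mathbf{p})$ is effective if $\mathrm{pr}_i(G)=\mathbb{Z}/p_i\mathbb{Z}$ for all $i$.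 A group homomorphism $\pi\colon\mathbb{L}(\mathbf{p})\to\mathbb{L}(\mathbf{q})$ is admissible if (1) $\mathrm{im}\,\pi$ is (infinite and) effective in $\mathbb{L}(\mathbf{q})$, and (2) $\sum_{\vec{x}\in\pi^{-1}(\vec{z})}\mathrm{mult}(\vec{x})=\mathrm{mult}(\vec{z})$ for each $\vec{z}\in\mathrm{im}\,\pi$. Up to permutation, the domestic types are $()$, $(p)$, $(p_1,p_2)$, $(2,2,p_3)$, $(2,3,3)$, $(2,3,4)$, $(2,3,5)$, and the tubular types are $(2,2,2,2)$, $(3,3,3)$, $(4,4,2)$, $(6,3,2)$. *)

(* Defs.v *)
From HB Require Import structures.
From mathcomp Require Import all_boot all_order all_algebra.
From mathcomp Require Import boolp classical_sets cardinality fsbigop.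

Set Implicit Arguments.
Unset Strict Implicit.
Unset Printing Implicit Defensive.
Import Order.TTheory GRing.Theory Num.Theory.
Local Open Scope ring_scope.
Local Open Scope quotient_scope.

Definition weight_sequence (p : seq nat) : bool := all (leq 2) p.

(* Positions outside p carry the weight 1. *)
Definition weight (p : seq nat) (i : nat) : nat := nth 1%N p i.

(* The group L(p) is presented with one more generator c, the second component
   of the free group below, and the relations p_i x_i = c; this covers the
   empty sequence uniformly. *)
Definition free_string_group (p : seq nat) : zmodType :=
  ('rV[int]_(size p) * int)%type.

Definition relator (p : seq nat) (i : 'I_(size p)) : free_string_group p :=
  (delta_mx 0 i *+ weight p i, -1).

Definition string_relation (p : seq nat) : {pred free_string_group p} :=
  fun v => `[< inIntSpan [tuple relator i | i < size p] v >].

Arguments string_relation p _ : clear implicits.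

Lemma string_relationP (p : seq nat) (v : free_string_group p) :
  reflect (exists a : 'I_(size p) -> int, v = \sum_i relator i *~ a i)
          (v \in string_relation p).
Proof.
apply: (iffP (asboolP _)) => -[a ->].
  by exists a; apply: eq_bigr => i _; rewrite (nth_map i) ?size_enum_ord //
    nth_ord_enum.
exists [ffun i => a i]; apply: eq_bigr => i _.
by rewrite ffunE (nth_map i) ?size_enum_ord // nth_ord_enum.
Qed.

Lemma string_relation_closed (p : seq nat) : zmod_closed (string_relation p).
Proof.
split=> [|u v /string_relationP[a ->] /string_relationP[b ->]].
  by apply/string_relationP; exists (fun=> 0); rewrite big1.
apply/string_relationP; exists (fun i => a i - b i).
by rewrite -sumrB; apply: eq_bigr => i _; rewrite mulrzBr.
Qed.

HB.instance Definition _ (p : seq nat) :=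
  GRing.isZmodClosed.Build (free_string_group p) (string_relation p)
    (string_relation_closed p).

Definition string_group (p : seq nat) : zmodType :=
  Quotient.quot (string_relation p).

Definition string_pi (p : seq nat) (v : free_string_group p) : string_group p :=
  \pi_(Quotient.quot (string_relation p)) v.

Definition string_repr (p : seq nat) (x : string_group p) : free_string_group p :=
  repr (x : Quotient.quot (string_relation p)).

Definition gen (p : seq nat) (i : 'I_(size p)) : string_group p :=
  string_pi (delta_mx 0 i, 0).

Definition can_elt (p : seq nat) : string_group p := string_pi (0, 1).

Arguments gen {p} i.

Definition gens (p : seq nat) : seq (string_group p) :=
  [seq gen i | i <- enum 'I_(size p)].

Lemma string_pi_is_zmod_morphism (p : seq nat) : zmod_morphism (@string_pi p).
Proof. by move=> u v; rewrite /string_pi raddfB. Qed.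

HB.instance Definition _ (p : seq nat) :=
  GRing.isZmodMorphism.Build (free_string_group p) (string_group p)
    (@string_pi p) (@string_pi_is_zmod_morphism p).

Lemma string_reprK (p : seq nat) : cancel (@string_repr p) (@string_pi p).
Proof. by move=> x; rewrite /string_pi /string_repr reprK. Qed.

Lemma string_pi_eq (p : seq nat) (u v : free_string_group p) :
  (string_pi u == string_pi v) = (u - v \in string_relation p).
Proof. by rewrite Quotient.idealrBE. Qed.

Lemma gen_weight (p : seq nat) (i : 'I_(size p)) :
  gen i *+ weight p i = can_elt p.
Proof.
rewrite /gen -raddfMn; apply/eqP; rewrite string_pi_eq.
apply/string_relationP; exists (fun j => (j == i)%:Z).
rewrite (bigD1 i) //= eqxx mulr1z big1 ?addr0 => [|j /negPf->]; last first.
  by rewrite mulr0z.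
by rewrite [_ *+ _]surjective_pairing !raddfMn /= mul0rn /relator; congr pair; rewrite /= ?subr0 ?sub0r.
Qed.

Lemma free_string_group_decomp (p : seq nat) (v : free_string_group p) :
  v = \sum_i (delta_mx 0 i, 0) *~ v.1 0 i + (0, 1) *~ v.2.
Proof.
case: v => a l /=; rewrite [RHS]surjective_pairing; congr pair.
  rewrite raddfD raddf_sum /= raddfMz /= mul0rz addr0 [LHS]row_sum_delta.
  by apply: eq_bigr => i _; rewrite raddfMz /= -scaler_int intz.
rewrite raddfD raddf_sum /= raddfMz /= big1 ?add0r -?[1 *~ l]/(l%:~R) ?intz // => i _.
by rewrite raddfMz /= mul0rz.
Qed.

Lemma string_group_decomp (p : seq nat) (v : free_string_group p) :
  string_pi v = \sum_i gen i *~ v.1 0 i + can_elt p *~ v.2.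
Proof.
rewrite {1}[v]free_string_group_decomp raddfD raddf_sum /= raddfMz.
by congr (_ + _); apply: eq_bigr => i _; rewrite raddfMz.
Qed.

Lemma string_group_lift (p : seq nat) (A : zmodType)
    (y : 'I_(size p) -> A) (c : A) :
  (forall i, y i *+ weight p i = c) ->
  exists f : {additive string_group p -> A},
    (forall i, f (gen i) = y i) /\ f (can_elt p) = c.
Proof.
move=> yc.
pose F (v : free_string_group p) := \sum_i y i *~ v.1 0 i + c *~ v.2.
have Fadd : zmod_morphism F.
  move=> u v; rewrite /F /= mulrzBr opprD addrACA -sumrB; congr (_ + _).
  by apply: eq_bigr => i _; rewrite !mxE mulrzBr.
pose Fm := GRing.isZmodMorphism.Build _ _ F Fadd.
pose FF : {additive free_string_group p -> A} := HB.pack F Fm.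
have F0 v : v \in string_relation p -> F v = 0.
  move=> /string_relationP[a ->]; rewrite -[F]/(FF : _ -> _) raddf_sum big1 // => i _.
  rewrite raddfMz /= /F /= (bigD1 i) //= big1 ?addr0; last first.
    by move=> j ji; rewrite mulmxnE !mxE (negPf ji) andbF mul0rn mulr0z.
  by rewrite mulmxnE !mxE !eqxx mulrz_nat yc mulrN1z subrr mul0rz.
have Fpi v : F (string_repr (string_pi v)) = F v.
  apply/eqP; rewrite -subr_eq0 -Fadd; apply/eqP/F0.
  by rewrite -string_pi_eq string_reprK.
pose G (x : string_group p) := F (string_repr x).
have Gadd : zmod_morphism G.
  move=> x y'; rewrite /G -Fadd -[in LHS](string_reprK x) -[in LHS](string_reprK y').
  by rewrite -raddfB Fpi.
pose Gm := GRing.isZmodMorphism.Build _ _ G Gadd.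
pose GG : {additive string_group p -> A} := HB.pack G Gm.
exists GG; split=> [i|]; rewrite /= /G Fpi /F /=.
  rewrite mulr0z addr0 (bigD1 i) //= mxE !eqxx mulr1z big1 ?addr0 // => j ji.
  by rewrite mxE (negPf ji) andbF mulr0z.
by rewrite mulr1z big1 ?add0r // => i _; rewrite mxE mulr0z.
Qed.

Lemma string_relation_coord (p : seq nat) (v : free_string_group p) :
  v \in string_relation p <->
  exists k : 'I_(size p) -> int,
    (forall i, v.1 0 i = (weight p i)%:Z * k i) /\ v.2 = - \sum_i k i.
Proof.
have E (k : 'I_(size p) -> int) : \sum_i relator i *~ k i =
    (\row_i ((weight p i)%:Z * k i), - \sum_i k i).
  rewrite [LHS]surjective_pairing !raddf_sum /=; congr pair.
    rewrite [RHS]row_sum_delta; apply: eq_bigr => i _.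
    by rewrite raddfMz /= mxE -scaler_int intz -scaler_nat scalerA mulrC natz.
  by apply: eq_bigr => i _; rewrite raddfMz /= mulNrz intz.
split=> [/string_relationP[k ->]|[k [v1 v2]]].
  by exists k; rewrite E; split=> // i; rewrite mxE.
apply/string_relationP; exists k; rewrite E [v]surjective_pairing v2.
by congr pair; apply/rowP => i; rewrite mxE v1.
Qed.

Definition nf_coef (p : seq nat) (x : string_group p) (i : 'I_(size p)) : int :=
  ((string_repr x).1 ord0 i %% (weight p i)%:Z)%Z.

Definition nf_can (p : seq nat) (x : string_group p) : int :=
  (string_repr x).2 + \sum_i ((string_repr x).1 ord0 i %/ (weight p i)%:Z)%Z.

Lemma weight_gt0 (p : seq nat) (i : 'I_(size p)) :
  weight_sequence p -> (0 < weight p i)%N.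
Proof. by move=> /all_nthP-/(_ 1%N i (ltn_ord i)); exact: ltnW. Qed.

Lemma normal_form (p : seq nat) (x : string_group p) :
  weight_sequence p ->
  (forall i, 0 <= nf_coef x i < (weight p i)%:Z) /\
  x = \sum_i gen i *~ nf_coef x i + can_elt p *~ nf_can x.
Proof.
move=> wp; split=> [i|].
  have w0 := weight_gt0 i wp.
  by rewrite /nf_coef modz_ge0 ?ltz_pmod // gt_eqF.
rewrite -{1}(string_reprK x) string_group_decomp /nf_can.
rewrite mulrzDr addrCA addrC mulrz_sumr -big_split /=; congr (_ + _).
apply: eq_bigr => i _; rewrite {1}(divz_eq ((string_repr x).1 ord0 i) (weight p i)%:Z).
by rewrite mulrzDr addrC [X in gen i *~ X + _]mulrC mulrzA -pmulrn gen_weight.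
Qed.

Lemma normal_form_uniq (p : seq nat) (x : string_group p)
    (l : 'I_(size p) -> int) (m : int) :
  weight_sequence p ->
  (forall i, 0 <= l i < (weight p i)%:Z) ->
  x = \sum_i gen i *~ l i + can_elt p *~ m ->
  (forall i, nf_coef x i = l i) /\ nf_can x = m.
Proof.
move=> wp lb xE.
have : string_pi (string_repr x) == string_pi (\row_i l i, m).
  rewrite string_reprK xE string_group_decomp /=; apply/eqP; congr (_ + _).
  by apply: eq_bigr => i _; rewrite mxE.
rewrite string_pi_eq => /string_relation_coord[k [/= k1 k2]].
have rE i : (string_repr x).1 0 i = k i * (weight p i)%:Z + l i.
  by rewrite mulrC -k1 !mxE subrK.
have w0 (i : 'I_(size p)) : (weight p i)%:Z != 0 by have := weight_gt0 i wp; rewrite eqz_nat lt0n.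
have lm i : (l i %% (weight p i)%:Z)%Z = l i by rewrite modz_small.
have ld i : (l i %/ (weight p i)%:Z)%Z = 0 by rewrite divz_small.
split=> [i|]; first by rewrite /nf_coef rE modzMDl lm.
rewrite /nf_can (eq_bigr k) => [|i _]; last by rewrite rE divzMDl // ld addr0.
by apply/eqP; rewrite -subr_eq0 addrAC k2 addNr.
Qed.

Definition mult (p : seq nat) (x : string_group p) : int :=
  Num.max (nf_can x + 1) 0.

(* When p is a weight sequence, all weights are at least 2, so that 'Z_(weight p i)
   is the ring of integers modulo p_i. *)
Definition pr (p : seq nat) (i : 'I_(size p)) (x : string_group p) :
    'Z_(weight p i) :=
  ((string_repr x).1 0 i)%:~R.

Lemma pr_string_pi (p : seq nat) (i : 'I_(size p)) (v : free_string_group p) :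
  weight_sequence p -> pr i (string_pi v) = (v.1 0 i)%:~R.
Proof.
move=> wp; apply/eqP; rewrite -subr_eq0 /pr -mulrzBr.
have : string_pi (string_repr (string_pi v)) == string_pi v.
  by rewrite string_reprK.
rewrite string_pi_eq => /string_relation_coord[k [/(_ i) + _]].
rewrite /= !mxE => ->; rewrite mulrzA -pmulrn pchar_Zp ?mul0rz //.
by have /all_nthP-/(_ 1%N i (ltn_ord i)) := wp.
Qed.

Lemma pr_is_zmod_morphism (p : seq nat) (i : 'I_(size p)) :
  weight_sequence p -> zmod_morphism (pr i).
Proof.
move=> wp x y; rewrite -(string_reprK x) -(string_reprK y) -raddfB.
by rewrite !pr_string_pi //= !mxE mulrzBr.
Qed.

Lemma pr_gen (p : seq nat) (i j : 'I_(size p)) :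
  weight_sequence p -> pr i (gen j) = (i == j)%:R.
Proof. by move=> wp; rewrite pr_string_pi //= mxE eqxx; case: (i == j). Qed.

Local Open Scope classical_set_scope.

Definition effective (p : seq nat) (G : set (string_group p)) : Prop :=
  [/\ G 0, forall x y, G x -> G y -> G (x - y), infinite_set G
    & forall i : 'I_(size p), pr i @` G = [set: 'Z_(weight p i)]].

Lemma finite_fibre (p : seq nat) (A : zmodType)
    (pi : {additive string_group p -> A}) (z : A) :
  weight_sequence p -> infinite_set (range pi) ->
  finite_set (pi @^-1` [set z]).
Proof.
move=> wp; apply: contra_notP => fib.
pose w := (\max_(i < size p) weight p i)%N.
pose F := {ffun 'I_(size p) -> 'I_w}.
have nfF x : exists f : F, forall i, nf_coef x i = (f i : nat)%:Z.
  have [nx _] := normal_form x wp.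
  have lt i : (`|nf_coef x i| < w)%N.
    have /andP[n0 n1] := nx i; apply: leq_trans (leq_bigmax i).
    by rewrite -ltz_nat gez0_abs.
  exists [ffun i => Ordinal (lt i)] => i; rewrite ffunE /= gez0_abs //.
  by have /andP[] := nx i.
have [k k0 pik] : exists2 k : int, k != 0 & pi (can_elt p *~ k) = 0.
  apply: contra_notP fib => nok.
  have inj x y : pi x = z -> pi y = z -> nf_coef x =1 nf_coef y -> x = y.
    move=> xz yz xy; have [_ ex] := normal_form x wp.
    have [_ ey] := normal_form y wp.
    suff e : nf_can x = nf_can y.
      by rewrite ex ey e; congr (_ + _); apply: eq_bigr => i _; rewrite xy.
    apply/eqP; rewrite -subr_eq0; apply/negPn/negP => nz; apply: nok.
    exists (nf_can x - nf_can y) => //.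
    suff -> : can_elt p *~ (nf_can x - nf_can y) = x - y.
      by apply/eqP; rewrite raddfB subr_eq0 xz yz.
    have e : \sum_i gen i *~ nf_coef x i = \sum_i gen i *~ nf_coef y i.
      by apply: eq_bigr => i _; rewrite xy.
    rewrite [in RHS]ex [in RHS]ey e; move: (nf_can x) (nf_can y) => a b.
    by rewrite opprD addrACA subrr add0r mulrzBr.
  pose g (f : F) :=
    xget 0 [set x | pi x = z /\ forall i, nf_coef x i = (f i : nat)%:Z].
  apply: (@sub_finite_set _ _ (range g)); last exact/finite_image/finite_finset.
  move=> x /= xz; have [f fx] := nfF x; exists f => //.
  have [|yz fy] := @xgetPex _ 0
    [set x | pi x = z /\ forall i, nf_coef x i = (f i : nat)%:Z].
    by exists x.
  by apply: inj => // i; rewrite fx fy.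
pose h (u : F * 'I_`|k|) :=
  pi (\sum_i gen i *~ (u.1 i : nat)%:Z + can_elt p *~ (u.2 : nat)%:Z).
apply: (@sub_finite_set _ _ (range h)); last exact/finite_image/finite_finset.
move=> _ [x _ <-]; have [f fx] := nfF x.
have r0 : 0 <= (nf_can x %% k)%Z by rewrite modz_ge0.
have lt : (`|(nf_can x %% k)%Z| < `|k|)%N.
  by rewrite -ltz_nat gez0_abs // abszE ltz_mod.
exists (f, Ordinal lt) => //; rewrite /h /= gez0_abs //.
have [_ ex] := normal_form x wp.
rewrite [in RHS]ex [in RHS](divz_eq (nf_can x) k) mulrzDr !raddfD /=.
have -> : pi (can_elt p *~ ((nf_can x %/ k)%Z * k)) = 0.
  by rewrite mulrC mulrzA raddfMz pik mul0rz.
rewrite add0r; congr (pi _ + _).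
by apply: eq_bigr => i _; rewrite fx.
Qed.

(* Effectivity of the image is infiniteness plus the condition on projections.
   The finitely supported sum ranges over the whole fibre, by finite_fibre. *)
Definition admissible (p q : seq nat)
    (pi : {additive string_group p -> string_group q}) : Prop :=
  effective (range pi) /\
  forall z, range pi z ->
    \sum_(x \in pi @^-1` [set z]) mult x = mult z.

Definition kernel_generated_by (A B : zmodType) (pi : A -> B) (K : seq A) : Prop :=
  forall x, pi x = 0 <-> inIntSpan (in_tuple K) x.

Inductive weight_type := Domestic | Tubular.

Inductive standard_weights : weight_type -> seq nat -> Prop :=
| Dom0 : standard_weights Domestic [::]
| Dom1 (a : nat) of (2 <= a)%N : standard_weights Domestic [:: a]
| Dom2 (a b : nat) of (2 <= a)%N & (2 <= b)%N : standard_weights Domestic [:: a; b]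
| DomD (a : nat) of (2 <= a)%N : standard_weights Domestic [:: 2; 2; a]%N
| DomE6 : standard_weights Domestic [:: 2; 3; 3]%N
| DomE7 : standard_weights Domestic [:: 2; 3; 4]%N
| DomE8 : standard_weights Domestic [:: 2; 3; 5]%N
| TubD4 : standard_weights Tubular [:: 2; 2; 2; 2]%N
| TubE6 : standard_weights Tubular [:: 3; 3; 3]%N
| TubE7 : standard_weights Tubular [:: 4; 4; 2]%N
| TubE8 : standard_weights Tubular [:: 6; 3; 2]%N.

Definition has_type (T : weight_type) (p : seq nat) : Prop :=
  exists2 P, perm_eq p P & standard_weights T P.

Definition drop_ones (p : seq nat) : seq nat := [seq a <- p | a != 1%N].

(* row x1 x2 x3 x4 z1 z2 z3 z4 d T P Q K y: the generators of L(P) and L(Q) and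
   the canonical element of L(Q) being x_i, z_j, d, the list of type T contains
   the row P -> Q with kernel generated by K and images y of the x_i. *)
Inductive row (A B : zmodType) (x1 x2 x3 x4 : A) (z1 z2 z3 z4 d : B) :
    weight_type -> seq nat -> seq nat -> seq A -> seq B -> Prop :=
| RowD1 : row x1 x2 x3 x4 z1 z2 z3 z4 d Domestic
    [:: 2; 3; 4]%N [:: 2; 3; 3]%N
    [:: x1 - x3 *+ 2]
    [:: d; z2 + z3; z1]
| RowD2 : row x1 x2 x3 x4 z1 z2 z3 z4 d Domestic
    [:: 2; 3; 3]%N [:: 2; 2; 2]%N
    [:: x2 - x3]
    [:: z1 + z2 + z3; d; d]
| RowD3 (a : nat) of (1 <= a)%N : row x1 x2 x3 x4 z1 z2 z3 z4 d Domestic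
    [:: 2; 2; 2 * a]%N (drop_ones [:: 2; 2; a]%N)
    [:: x2 - x3 *+ a]
    [:: z1 + z2; d; z3]
| RowD4 (a : nat) of (1 <= a)%N : row x1 x2 x3 x4 z1 z2 z3 z4 d Domestic
    [:: 2; 2; 2 * a]%N (drop_ones [:: a; a])
    [:: x1 - x2; x1 - x3 *+ a]
    [:: d *+ 2; d *+ 2; z1 + z2]
| RowD5 (a : nat) of (2 <= a)%N : row x1 x2 x3 x4 z1 z2 z3 z4 d Domestic
    [:: 2; 2; a]%N [:: a; a]
    [:: x1 - x2]
    [:: d; d; z1 + z2]
| RowD6 (n a b : nat) of (2 <= n)%N & (2 <= a)%N & (2 <= b)%N :
    row x1 x2 x3 x4 z1 z2 z3 z4 d Domestic
    [:: n * a; n * b]%N [:: a; b]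
    [:: x1 *+ a - x2 *+ b]
    [:: z1; z2]
| RowD7 (n a : nat) of (2 <= n)%N & (2 <= a)%N :
    row x1 x2 x3 x4 z1 z2 z3 z4 d Domestic
    [:: n * a; n]%N [:: a]
    [:: x1 *+ a - x2]
    [:: z1; d]
| RowD8 (n : nat) of (2 <= n)%N : row x1 x2 x3 x4 z1 z2 z3 z4 d Domestic
    [:: n; n] [::]
    [:: x1 - x2]
    [:: d; d]
| RowT1 : row x1 x2 x3 x4 z1 z2 z3 z4 d Tubular
    [:: 2; 2; 2; 2]%N [:: 2; 2; 2; 2]%N
    [:: x1 - x2]
    [:: d; d; z1 + z2; z3 + z4]
| RowT2 : row x1 x2 x3 x4 z1 z2 z3 z4 d Tubular
    [:: 2; 2; 2; 2]%N [:: 2; 2; 2; 2]%N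
    [:: x1 - x2; x1 - x3]
    [:: d *+ 2; d *+ 2; d *+ 2; z1 + z2 + z3 + z4]
| RowT3 : row x1 x2 x3 x4 z1 z2 z3 z4 d Tubular
    [:: 4; 4; 2]%N [:: 4; 4; 2]%N
    [:: x1 *+ 2 - x3]
    [:: z3; z1 + z2; d]
| RowT4 : row x1 x2 x3 x4 z1 z2 z3 z4 d Tubular
    [:: 4; 4; 2]%N [:: 2; 2; 2; 2]%N
    [:: x1 - x2]
    [:: d; d; z1 + z2 + z3 + z4]
| RowT5 : row x1 x2 x3 x4 z1 z2 z3 z4 d Tubular
    [:: 4; 4; 2]%N [:: 2; 2; 2; 2]%N
    [:: x1 *+ 2 - x2 *+ 2]
    [:: z1; z2; z3 + z4]
| RowT6 : row x1 x2 x3 x4 z1 z2 z3 z4 d Tubular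
    [:: 4; 4; 2]%N [:: 2; 2; 2; 2]%N
    [:: x1 *+ 2 - x2 *+ 2; x1 *+ 2 - x3]
    [:: z1 + z2; z3 + z4; d *+ 2]
| RowT7 : row x1 x2 x3 x4 z1 z2 z3 z4 d Tubular
    [:: 3; 3; 3]%N [:: 3; 3; 3]%N
    [:: x1 - x2]
    [:: d; d; z1 + z2 + z3]
| RowT8 : row x1 x2 x3 x4 z1 z2 z3 z4 d Tubular
    [:: 6; 3; 2]%N [:: 3; 3; 3]%N
    [:: x1 *+ 3 - x3]
    [:: z1; z2 + z3; d]
| RowT9 : row x1 x2 x3 x4 z1 z2 z3 z4 d Tubular
    [:: 6; 3; 2]%N [:: 2; 2; 2; 2]%N
    [:: x1 *+ 2 - x2]
    [:: z1; d; z2 + z3 + z4].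

(* Positions beyond the end of a list of generators stand for entries equal
   to 1; their generator is the canonical element c (resp. d). *)
Definition row_on (A B : zmodType) (xs : seq A) (c : A) (zs : seq B) (d : B) :=
  row (nth c xs 0) (nth c xs 1) (nth c xs 2) (nth c xs 3)
      (nth d zs 0) (nth d zs 1) (nth d zs 2) (nth d zs 3) d.

(* "Up to permutation of the entries (with the generators)" is expressed by
   lists of pairs that are perm_eq to this one. *)
Definition weighted_gens (p : seq nat) : seq (nat * string_group p) :=
  zip p (gens p).

(* Main.v *)
Require Import Defs.
From mathcomp Require Import all_boot all_order all_algebra.
From mathcomp Require Import boolp classical_sets cardinality fsbigop.
From mathcomp Require Import zify.

(** Geometrically, an admissible homomorphism with kernel H presents the weighted
    projective line of type p as the quotient of the one of type q by the finite
    abelian group dual to H. This group acts on a curve of genus 0, so it is cyclic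
    or a Klein four-group. The proof is a combinatorial version of this argument.

    Put euler x = nf_can x + 1; then mult x is its positive part. Applying the
    counting condition to x + k c for large k removes the positive parts: the
    values of euler on x + H add up to euler (pi x), for every x
    (euler_sum_kernel). For each index i, the residues of the i-th coefficients of
    H are the multiples of some f_i dividing p_i, each attained r_i times. Adding
    the identities at x and - x gives the size of the support of pi x and, for
    x = 0, the Riemann-Hurwitz formula of genus 0. The supports of the
    images of the x_i with f_i > 1 are therefore disjoint of size r_i; effectivity
    makes the weights there equal to f_i, and the identity at f_i x_i makes all the
    coefficients equal to 1 (standard_form). With e_i = p_i / f_i and N = |H|, the
    formula says that the sum of the 1 - 1/e_i is 2 - 2/N. As H is abelian, this
    leaves two indices with e_i = N, or three with e_i = 2 and N = 4
    (genus0_abelian_ramification).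

    Conversely, let pi be of standard form. If a list of kernel elements
    has the expected residues and consists of 0 and of elements of Euler
    characteristic 0, then the two sides of the identity have the same
    increments along the generators, so the identity holds; it forces the list to
    be the whole kernel and pi to be admissible (recognition). This applies to the
    multiples of f_i x_i - f_j x_j in the first case (cyclic_kernel), and to the
    group generated by f_i x_i - f_j x_j and f_i x_i - f_k x_k in the second
    (klein_kernel). So pi is determined, with its kernel, by a choice of two
    entries of p and a common divisor N > 1 of them, or of three even entries; for
    the types considered these choices are exactly the rows. *)

Set Implicit Arguments.
Unset Strict Implicit.
Unset Printing Implicit Defensive.
Import Order.TTheory GRing.Theory Num.Theory.
Local Open Scope ring_scope.

(** * Normal forms, supports and degrees *)

(** Replacing p_i x_i by c turns an arbitrary integral combination into a normal
    form: each coefficient is reduced modulo its weight and the quotients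
    are carried over to the canonical element. *)
Lemma nf_combination (p : seq nat) (x : string_group p) (l : 'I_(size p) -> int)
    (m : int) :
  weight_sequence p -> x = \sum_i gen i *~ l i + can_elt p *~ m ->
  (forall i, nf_coef x i = (l i %% (weight p i)%:Z)%Z) /\
  nf_can x = m + \sum_i (l i %/ (weight p i)%:Z)%Z.
Proof.
move=> wp ->; apply: normal_form_uniq => // [i|].
  have w0 := weight_gt0 i wp.
  by rewrite modz_ge0 ?ltz_pmod // gt_eqF.
rewrite mulrzDr addrCA addrC mulrz_sumr -big_split /=; congr (_ + _).
apply: eq_bigr => i _; rewrite {1}(divz_eq (l i) (weight p i)%:Z).
by rewrite mulrzDr addrC [X in gen i *~ X + _]mulrC mulrzA -pmulrn gen_weight.
Qed.

Lemma weight_gt1 (p : seq nat) (i : 'I_(size p)) :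
  weight_sequence p -> (1 < weight p i)%N.
Proof. by move=> /all_nthP-/(_ 1%N i (ltn_ord i)). Qed.

Lemma nf_coef_range (p : seq nat) (x : string_group p) (i : 'I_(size p)) :
  weight_sequence p -> 0 <= nf_coef x i < (weight p i)%:Z.
Proof. by move=> wp; case: (normal_form x wp). Qed.

Lemma nf_coef_mod (p : seq nat) (x : string_group p) (i : 'I_(size p)) :
  (nf_coef x i %% (weight p i)%:Z)%Z = nf_coef x i.
Proof. by rewrite /nf_coef modz_mod. Qed.

Lemma nfD (p : seq nat) (x y : string_group p) : weight_sequence p ->
  (forall i, nf_coef (x + y) i =
     ((nf_coef x i + nf_coef y i) %% (weight p i)%:Z)%Z) /\
  nf_can (x + y) = nf_can x + nf_can y +
     \sum_i ((nf_coef x i + nf_coef y i) %/ (weight p i)%:Z)%Z.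
Proof.
move=> wp; apply: nf_combination => //.
have [_ ex] := normal_form x wp; have [_ ey] := normal_form y wp.
rewrite {1}ex {1}ey addrACA -big_split /= -mulrzDr; congr (_ + _).
by apply: eq_bigr => i _; rewrite mulrzDr.
Qed.

Lemma nf_coefD (p : seq nat) (x y : string_group p) (i : 'I_(size p)) :
  weight_sequence p ->
  nf_coef (x + y) i = ((nf_coef x i + nf_coef y i) %% (weight p i)%:Z)%Z.
Proof. by move=> wp; case: (nfD x y wp). Qed.

Lemma nf_mulrz_can (p : seq nat) (k : int) : weight_sequence p ->
  (forall i, nf_coef (can_elt p *~ k) i = 0) /\ nf_can (can_elt p *~ k) = k.
Proof.
move=> wp; have [|c1 c2] := @nf_combination p (can_elt p *~ k) (fun=> 0) k wp.
  by rewrite big1 ?add0r // => i _; rewrite mulr0z.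
split=> [i|]; first by rewrite c1 mod0z.
by rewrite c2 big1 ?addr0 // => i _; rewrite div0z.
Qed.

Lemma nf0 (p : seq nat) : weight_sequence p ->
  (forall i, nf_coef (0 : string_group p) i = 0) /\ nf_can (0 : string_group p) = 0.
Proof. by move=> wp; have := nf_mulrz_can 0 wp; rewrite mulr0z. Qed.

Lemma nf_coef_inj (p : seq nat) (x y : string_group p) : weight_sequence p ->
  (forall i, nf_coef x i = nf_coef y i) -> nf_can x = nf_can y -> x = y.
Proof.
move=> wp e1 e2; have [_ ->] := normal_form x wp; have [_ ->] := normal_form y wp.
by rewrite e2; congr (_ + _); apply: eq_bigr => i _; rewrite e1.
Qed.

Lemma nf_coefMn (p : seq nat) (x : string_group p) (i : 'I_(size p)) (k : nat) :
  weight_sequence p ->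
  nf_coef (x *+ k) i = ((nf_coef x i * k%:Z) %% (weight p i)%:Z)%Z.
Proof.
move=> wp; elim: k => [|k IH].
  by rewrite mulr0n mulr0 mod0z; case: (nf0 wp).
by rewrite mulrSr nf_coefD // IH modzDml intS mulrDr mulr1 addrC.
Qed.

Lemma nf_coefN (p : seq nat) (x : string_group p) (i : 'I_(size p)) :
  weight_sequence p ->
  nf_coef (- x) i = ((- nf_coef x i) %% (weight p i)%:Z)%Z.
Proof.
move=> wp; have := nf_coefD x (- x) i wp; rewrite subrr; have [-> _] := nf0 wp.
move=> e; rewrite -[LHS]nf_coef_mod; apply/eqP.
by rewrite eqz_mod_dvd opprK addrC; apply/dvdz_mod0P.
Qed.

Lemma nf_coefMz (p : seq nat) (x : string_group p) (i : 'I_(size p)) (k : int) :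
  weight_sequence p ->
  nf_coef (x *~ k) i = ((nf_coef x i * k) %% (weight p i)%:Z)%Z.
Proof.
move=> wp; case: k => k; first exact: nf_coefMn.
by rewrite NegzE -nmulrn nf_coefN // nf_coefMn // modzNm mulrN.
Qed.

Lemma nf_coef_sum (p : seq nat) (I : Type) (s : seq I) (F : I -> string_group p)
    (i : 'I_(size p)) :
  weight_sequence p ->
  nf_coef (\sum_(j <- s) F j) i =
  ((\sum_(j <- s) nf_coef (F j) i) %% (weight p i)%:Z)%Z.
Proof.
move=> wp; elim: s => [|j s IH].
  by rewrite !big_nil mod0z; case: (nf0 wp).
by rewrite !big_cons nf_coefD // IH modzDmr.
Qed.

Lemma nf_gen (p : seq nat) (i : 'I_(size p)) : weight_sequence p ->
  (forall j, nf_coef (gen i) j = (j == i)%:Z) /\ nf_can (gen i) = 0.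
Proof.
move=> wp; have [|c1 c2] := @nf_combination p (gen i) (fun j => (j == i)%:Z) 0 wp.
  rewrite mulr0z addr0 (bigD1 i) //= eqxx mulr1z big1 ?addr0 // => j /negPf->.
  by rewrite mulr0z.
have b j : 0 <= ((j == i)%:Z) < (weight p j)%:Z.
  by have := weight_gt1 j wp; case: (j == i) => /=; lia.
split=> [j|]; first by rewrite c1 modz_small.
by rewrite c2 add0r big1 // => j _; rewrite divz_small // ger0_norm.
Qed.

(** An equivalence in the induction step accounts for the negatives of the
    generators. For the empty sequence there are no x_i, and c generates. *)
Lemma string_group_ind_gen (p : seq nat) (P : string_group p -> Prop) :
  (0 < size p)%N -> P 0 ->
  (forall x i, P x <-> P (x + gen i)) -> forall x, P x.
Proof.
move=> p0 P0 PD.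
have PMz x i (k : int) : P x -> P (x + gen i *~ k).
  elim: k x => [|k IH|k IH] x Px; first by rewrite mulr0z addr0.
    by rewrite intS mulrzDr mulr1z addrA; apply/IH/(PD x i).1.
  rewrite intS opprD mulrzDr mulrN1z addrA; apply: IH.
  by apply: (PD _ i).2; rewrite subrK.
have PS (s : seq 'I_(size p)) (l : 'I_(size p) -> int) x :
    P x -> P (x + \sum_(i <- s) gen i *~ l i).
  elim: s x => [|i s IH] x Px; first by rewrite big_nil addr0.
  by rewrite big_cons addrA; apply/IH/PMz.
move=> x; rewrite -(string_reprK x) string_group_decomp.
rewrite -(gen_weight (Ordinal p0)) pmulrn -mulrzA; apply: PMz.
by rewrite -[X in P X]add0r; apply: PS.
Qed.

(** The Euler characteristic of the line bundle of class x on a weighted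
    projective line: mult x is its positive part. Unlike mult it turns the
    counting condition on fibres into an identity valid at every x. *)
Definition euler (p : seq nat) (x : string_group p) : int := nf_can x + 1.

Lemma mult_euler (p : seq nat) (x : string_group p) : mult x = Num.max (euler x) 0.
Proof. by []. Qed.

Lemma euler0 (p : seq nat) : weight_sequence p -> euler (0 : string_group p) = 1.
Proof. by move=> wp; rewrite /euler; have [_ ->] := nf0 wp. Qed.

Lemma euler_addc (p : seq nat) (x : string_group p) (k : int) :
  weight_sequence p -> euler (x + can_elt p *~ k) = euler x + k.
Proof.
move=> wp; rewrite /euler; have [_ ->] := nfD x (can_elt p *~ k) wp.
have [c1 ->] := nf_mulrz_can k wp; rewrite big1 => [|i _]; first by rewrite addr0 addrAC.
by rewrite c1 addr0 divz_small //; exact: nf_coef_range.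
Qed.

Lemma nf_coef_addc (p : seq nat) (x : string_group p) (k : int) (i : 'I_(size p)) :
  weight_sequence p -> nf_coef (x + can_elt p *~ k) i = nf_coef x i.
Proof.
move=> wp; rewrite nf_coefD //; have [-> _] := nf_mulrz_can k wp.
by rewrite addr0 nf_coef_mod.
Qed.

(** Adding x_i only carries over when the coefficient wraps around to 0. *)
Lemma euler_addgen (p : seq nat) (x : string_group p) (i : 'I_(size p)) :
  weight_sequence p ->
  euler (x + gen i) = euler x + (nf_coef (x + gen i) i == 0)%:Z.
Proof.
move=> wp; rewrite /euler; have [e1 ->] := nfD x (gen i) wp.
have [g1 ->] := nf_gen i wp; rewrite addr0 addrAC; congr (_ + _).
rewrite (bigD1 i) //= big1 ?addr0 => [|j /negPf ji]; last first.
  by rewrite g1 ji addr0 divz_small //; have := nf_coef_range x j wp; lia.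
rewrite e1 g1 eqxx; have := nf_coef_range x i wp; have := weight_gt1 i wp.
set w := weight p i; set a := nf_coef x i => w1 /andP[a0 aw].
have [e|ne] := eqVneq (a + 1) w%:Z.
  by rewrite e modzz eqxx divzz; case: eqP => //; lia.
have b : 0 <= a + 1 < w%:Z by lia.
by rewrite modz_small // divz_small ?ger0_norm //; case: eqP => //; lia.
Qed.

Lemma nf_can_superadditive (p : seq nat) (x y : string_group p) :
  weight_sequence p -> nf_can x + nf_can y <= nf_can (x + y).
Proof.
move=> wp; have [_ ->] := nfD x y wp; rewrite lerDl sumr_ge0 // => i _.
have := nf_coef_range x i wp; have := nf_coef_range y i wp.
by rewrite divz_ge0 ?ltz_nat ?weight_gt0 //; lia.
Qed.

Definition supp (p : seq nat) (x : string_group p) : nat :=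
  \sum_i (nf_coef x i != 0).

(** Changing the sign of x complements its nonzero coefficients to the weights, so
    that each of them carries 1 into the canonical element when x and - x are
    added up to 0. *)
Lemma euler_opp (p : seq nat) (x : string_group p) :
  weight_sequence p -> euler x + euler (- x) = 2 - (supp x)%:Z.
Proof.
move=> wp; rewrite /euler /supp; have [_] := nfD x (- x) wp.
rewrite subrr; have [_ ->] := nf0 wp.
rewrite (eq_bigr (fun i => (nf_coef x i != 0)%:Z)) => [|i _]; last first.
  have := nf_coefN x i wp; have := nf_coef_range x i wp.
  have := weight_gt1 i wp => w1 a1 e; have [z|nz] := eqVneq (nf_coef x i) 0.
    by rewrite e z oppr0 add0r mod0z div0z.
  have -> : nf_coef (- x) i = (weight p i)%:Z - nf_coef x i.
    rewrite e -modzDl modz_small //; lia.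
  by rewrite addrC subrK divzz; case: eqP => //; lia.
by rewrite (big_morph Posz PoszD (erefl 0%:Z)); move: (\sum_i _); lia.
Qed.

Lemma nf_coef_eq0 (p : seq nat) (x : string_group p) (i : 'I_(size p)) (k : int) :
  weight_sequence p -> nf_coef x i = (k %% (weight p i)%:Z)%Z ->
  (nf_coef x i == 0) = ((weight p i)%:Z %| k)%Z.
Proof. by move=> wp ->; apply/eqP/dvdz_mod0P. Qed.

(** The degree, normalised by deg c = 1. It vanishes on torsion elements, and all
    terms of the formula except the last one are nonnegative. *)
Lemma degree_exists (p : seq nat) : weight_sequence p ->
  exists deg : {additive string_group p -> rat},
    forall x, deg x = \sum_i (nf_coef x i)%:~R / (weight p i)%:R + (nf_can x)%:~R.
Proof.
move=> wp.
have [|deg [dg dc]] :=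
    @string_group_lift p rat (fun i => (weight p i)%:R^-1) 1.
  by move=> i; rewrite -[LHS]mulr_natr mulVf // pnatr_eq0 -lt0n weight_gt0.
exists deg => x; have [_ {1}->] := normal_form x wp.
rewrite raddfD raddf_sum /= raddfMz /= dc; congr (_ + _).
by apply: eq_bigr => i _; rewrite raddfMz /= dg -mulrzl.
Qed.

(** * Euler characteristics along the kernel *)

Record kernel_enum (p q : seq nat) (pi : {additive string_group p -> string_group q})
    (hs : seq (string_group p)) : Prop := KernelEnum {
  kernel_enum_uniq : uniq hs;
  kernel_enumP : forall x, (x \in hs) = (pi x == 0) }.

(** Fibres are translates of the kernel. *)
Lemma fibre_mult_sum (p q : seq nat)
    (pi : {additive string_group p -> string_group q}) (hs : seq (string_group p))
    (x : string_group p) :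
  kernel_enum pi hs ->
  \sum_(y \in (pi @^-1` [set pi x])%classic) mult y = \sum_(h <- hs) mult (x + h).
Proof.
case=> uh hsP.
have -> : (pi @^-1` [set pi x])%classic = [set` [seq x + h | h <- hs]]%classic.
  apply/seteqP; split=> y /=.
    move=> /= e; apply/mapP; exists (y - x); last by rewrite addrC subrK.
    by rewrite hsP raddfB e subrr.
  by move=> /mapP[h]; rewrite hsP => /eqP h0 ->; rewrite raddfD /= h0 addr0.
rewrite -fsbig_seq ?big_map // map_inj_uniq //; exact: addrI.
Qed.

Lemma common_order (q : seq nat) : weight_sequence q ->
  exists2 M : nat, (0 < M)%N &
    forall z : string_group q, exists m, z *+ M = can_elt q *~ m.
Proof.
move=> wq; exists (\prod_(j < size q) weight q j)%N.
  by rewrite prodn_gt0 // => j; apply: weight_gt0.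
move=> z; exists (nf_can (z *+ (\prod_(j < size q) weight q j))).
apply: nf_coef_inj => // [j|]; have [c1 c2] := nf_mulrz_can
    (nf_can (z *+ (\prod_(j < size q) weight q j))) wq; last by rewrite c2.
rewrite c1 nf_coefMn //; apply/dvdz_mod0P; rewrite dvdz_mull //.
by rewrite dvdzE /= (bigD1 j) //= dvdn_mulr.
Qed.

(** The counting condition at x + kc for two large consecutive k removes the
    positive parts: all Euler characteristics involved are then positive. *)
Lemma euler_sum_kernel (p q : seq nat)
    (pi : {additive string_group p -> string_group q}) (hs : seq (string_group p)) :
  weight_sequence p -> weight_sequence q -> admissible pi -> kernel_enum pi hs ->
  forall x, \sum_(h <- hs) euler (x + h) = euler (pi x).
Proof.
move=> wp wq [_ adm] hsK x.
have [M M0 /(_ (pi (can_elt p)))[m piM]] := common_order wq.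
have s0 : (0 < size hs)%N.
  have : (0 : string_group p) \in hs by rewrite (kernel_enumP hsK) raddf0.
  by case: hs {hsK}.
pose Phi := \sum_(h <- hs) euler (x + h).
pose B := \sum_(h <- hs) `|euler (x + h)|.
have shift (L : int) : B < L ->
    Phi + (size hs)%:Z * (M%:Z * L) = euler (pi x) + m * L.
  move=> BL.
  have B0 : 0 <= B by apply: sumr_ge0.
  have ML : L <= M%:Z * L by nia.
  have hB h : h \in hs -> - (M%:Z * L) < euler (x + h).
    move=> hin; have : `|euler (x + h)| <= B.
      by rewrite /B (big_rem h) //= lerDl sumr_ge0.
    by lia.
  have PB : - B <= Phi.
    by rewrite lerNl; apply: le_trans (ler_norm _) _; rewrite normrN ler_norm_sum.
  have := adm (pi (x + can_elt p *~ (M%:Z * L))) _.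
  rewrite (fibre_mult_sum _ hsK) => /(_ (ex_intro2 _ _ _ I erefl)).
  have -> : \sum_(h <- hs) mult (x + can_elt p *~ (M%:Z * L) + h) =
      Phi + (size hs)%:Z * (M%:Z * L).
    transitivity (\sum_(h <- hs) (euler (x + h) + M%:Z * L)).
      rewrite big_seq [RHS]big_seq; apply: eq_bigr => h hin.
      by rewrite addrAC mult_euler euler_addc // max_l //; have := hB h hin;
        rewrite -lerBlDr sub0r; exact: ltW.
    by rewrite big_split /= big_const_seq count_predT iter_addr addr0 -mulr_natl natz.
  rewrite mult_euler raddfD raddfMz mulrzA -pmulrn piM -mulrzA euler_addc // maxEle.
  by case: ifP => //; move: B0 PB ML s0; move: (size hs) => N; nia.
have e1 := shift (B + 1) _; have e2 := shift (B + 2) _.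
have : (size hs)%:Z * M%:Z = m.
  have : (size hs)%:Z * (M%:Z * (B + 2)) - (size hs)%:Z * (M%:Z * (B + 1)) =
    m * (B + 2) - m * (B + 1) by lia.
  by rewrite -!mulrBr; lia.
by move=> mE; have := e1 ltac:(lia); rewrite -mE mulrA; lia.
Qed.

Lemma admissible_kernel (p q : seq nat)
    (pi : {additive string_group p -> string_group q}) :
  weight_sequence p -> admissible pi -> exists hs, kernel_enum pi hs.
Proof.
move=> wp [[_ _ inf _] _].
have /finite_seqP[s sE] := @finite_fibre p _ pi 0 wp inf.
exists (undup s); split; first exact: undup_uniq.
move=> x; rewrite mem_undup; apply/idP/eqP => [xs|px].
  by have : (pi @^-1` [set 0])%classic x by rewrite sE.
by have : [set` s]%classic x by rewrite -sE.
Qed.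

(** * Ramification of an admissible homomorphism *)

Lemma subgroup_of_int (A : pred int) (n : nat) :
  (0 < n)%N -> A n%:Z -> (forall a b, A a -> A b -> A (a - b)) ->
  exists2 f : nat, (0 < f)%N & forall k, A k = (f%:Z %| k)%Z.
Proof.
move=> n0 An AB.
have A0 : A 0 by rewrite -(subrr n%:Z) AB.
have AN a : A a -> A (- a) by move=> ?; rewrite -sub0r AB.
have AD a b : A a -> A b -> A (a + b).
  by move=> ? ?; rewrite -[b]opprK AB // AN.
have AM a k : A a -> A (a * k).
  elim: k => [|k IH|k IH] Aa; first by rewrite mulr0.
    by rewrite intS mulrDr mulr1 AD // IH.
  by rewrite intS opprD mulrDr mulrN1 AD ?AN // IH.
have ex : exists m, (0 < m)%N && A m%:Z by exists n; rewrite n0.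
case: (ex_minnP ex) => f /andP[f0 Af] fmin; exists f => // k.
apply/idP/idP => [Ak|/dvdzP[c ->]]; last by rewrite mulrC AM.
apply/dvdz_mod0P; have r0 : 0 <= (k %% f%:Z)%Z by rewrite modz_ge0 // eqz_nat -lt0n.
have rf : (k %% f%:Z)%Z < f%:Z by rewrite ltz_pmod.
have Ar : A (k %% f%:Z)%Z by rewrite /modz AB // mulrC AM.
apply/eqP/negPn/negP => nz; have := fmin `|(k %% f%:Z)%Z|%N.
by rewrite gez0_abs // Ar; lia.
Qed.

Lemma dvdz_modDl (w a b : int) : (w %| (a %% w)%Z + b)%Z = (w %| a + b)%Z.
Proof. by rewrite !(sameP dvdz_mod0P eqP) modzDml. Qed.

Lemma sumn_leq_eq (I : finType) (a b : I -> nat) :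
  (forall i, a i <= b i)%N -> (\sum_i a i = \sum_i b i)%N -> forall i, a i = b i.
Proof.
move=> ab e i; have [_] := leqif_sum (fun i (_ : xpredT i) => leqif_eq (ab i)).
by rewrite e eqxx => /esym/forall_inP/(_ i isT)/eqP.
Qed.

(** For k the i-th coefficient of x, ram hs i k is the number of carries into the
    canonical element at the index i when x - x_i is replaced by x in all the
    translates along hs. *)
Definition ram (p : seq nat) (hs : seq (string_group p)) (i : 'I_(size p)) (k : int)
    : nat :=
  count (fun h => ((weight p i)%:Z %| nf_coef h i + k)%Z) hs.

Lemma kernel_shift (p q : seq nat)
    (pi : {additive string_group p -> string_group q}) (hs : seq (string_group p)) g :
  kernel_enum pi hs -> g \in hs -> perm_eq [seq h + g | h <- hs] hs.
Proof.
move=> [uh hsP]; rewrite hsP => /eqP g0.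
apply: uniq_perm => //; first by rewrite map_inj_uniq //; exact: addIr.
move=> x; apply/mapP/idP => [[h + ->]|].
  by rewrite !hsP raddfD /= g0 addr0.
rewrite hsP => /eqP x0.
by exists (x - g); rewrite ?subrK // hsP raddfB /= x0 g0 subrr.
Qed.

Lemma kernel_opp (p q : seq nat)
    (pi : {additive string_group p -> string_group q}) (hs : seq (string_group p)) :
  kernel_enum pi hs -> perm_eq [seq - h | h <- hs] hs.
Proof.
move=> [uh hsP]; apply: uniq_perm => //.
  by rewrite map_inj_uniq //; exact: oppr_inj.
move=> x; apply/mapP/idP => [[h + ->]|]; rewrite !hsP.
  by rewrite raddfN oppr_eq0.
by move=> x0; exists (- x); rewrite ?opprK // hsP raddfN /= oppr_eq0.
Qed.

(** The integers k with ram hs i k > 0 form a subgroup, and translation by kernel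
    elements shows that ram hs i takes the same value at all of them. *)
Lemma ramP (p q : seq nat)
    (pi : {additive string_group p -> string_group q}) (hs : seq (string_group p)) :
  weight_sequence p -> kernel_enum pi hs -> forall i, exists2 f : nat, (0 < f)%N &
  forall k, ram hs i k = if (f%:Z %| k)%Z then ram hs i 0 else 0%N.
Proof.
move=> wp hsK i; have [uh hsP] := hsK.
pose A k := has (fun h => ((weight p i)%:Z %| nf_coef h i + k)%Z) hs.
have h0 : 0 \in hs by rewrite hsP raddf0.
have [|a b|f f0 fP] := @subgroup_of_int A (weight p i) (weight_gt0 i wp).
- apply/hasP; exists 0 => //; have [-> _] := nf0 wp.
  by rewrite add0r dvdzz.
- move=> /hasP[g gin ga] /hasP[h hin hb]; apply/hasP; exists (g - h).
    by move: gin hin; rewrite !hsP raddfB => /eqP-> /eqP->; rewrite subrr.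
  rewrite nf_coefD // nf_coefN // modzDmr dvdz_modDl addrACA -opprD.
  by rewrite rpredB.
exists f => // k; rewrite -fP; case: ifPn => [/hasP[g gin gk]|]; last first.
  by rewrite /A has_count -leqNgt leqn0 => /eqP.
rewrite /ram -(permP (kernel_shift hsK gin)) count_map; apply: eq_count => h /=.
by rewrite nf_coefD // dvdz_modDl -addrA addr0 rpredDr.
Qed.

Lemma sum_vanishing_ram (p : seq nat) (hs : seq (string_group p)) x
    (i : 'I_(size p)) : weight_sequence p ->
  (\sum_(h <- hs) (nf_coef (x + h)%R i == 0))%N = ram hs i (nf_coef x i).
Proof.
move=> wp; rewrite /ram -sum1_count [RHS]big_mkcond; apply: eq_bigr => h _.
rewrite nf_coefD // addrC; set k := _ + _; rewrite (_ : _ == 0 = (weight p i %| k)%Z).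
  by case: (_ %| _)%Z.
by rewrite (sameP dvdz_mod0P eqP).
Qed.

Section Ramification.
Variables (p q : seq nat) (pi : {additive string_group p -> string_group q}).
Variable hs : seq (string_group p).
Hypotheses (wp : weight_sequence p) (wq : weight_sequence q).
Hypothesis (hsK : kernel_enum pi hs).
Hypothesis eulerK : forall x, \sum_(h <- hs) euler (x + h) = euler (pi x).

Let N := size hs.

Lemma kernel_size_gt0 : (0 < size hs)%N.
Proof.
have : 0 \in hs by rewrite (kernel_enumP hsK) raddf0.
by case: (hs).
Qed.

Lemma ram0_gt0 i : (0 < ram hs i 0)%N.
Proof.
rewrite -has_count; apply/hasP; exists 0; first by rewrite (kernel_enumP hsK) raddf0.
by have [-> _] := nf0 wp; rewrite addr0 dvdz0.
Qed.

(** Comparing the Euler characteristics of x and - x upstairs and downstairs;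
    for x = 0 this is the Riemann-Hurwitz formula for maps between curves of
    genus 0. *)
Lemma supp_image x :
  (2 * N + \sum_i ram hs i (nf_coef x i) + supp (pi x) = N * size p + 2)%N.
Proof.
have e1 : euler (pi x) + euler (pi (- x)) = \sum_(h <- hs) (2 - (supp (x + h))%:Z).
  rewrite -!eulerK -[X in _ + X](perm_big _ (kernel_opp hsK)) big_map -big_split /=.
  by apply: eq_bigr => h _; rewrite -opprD euler_opp.
have e2 : (\sum_(h <- hs) supp (x + h)%R + \sum_i ram hs i (nf_coef x i) = N * size p)%N.
  rewrite /supp exchange_big -big_split /=.
  rewrite (eq_bigr (fun=> N)) => [|i _]; first by rewrite sum_nat_const card_ord mulnC.
  rewrite -sum_vanishing_ram // -big_split /= (eq_bigr (fun=> 1%N)) => [|h _].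
    by rewrite sum1_size.
  by case: eqP.
move: e1; rewrite raddfN euler_opp // big_split /= big_const_seq count_predT iter_addr.
rewrite sumrN -(big_morph Posz PoszD (erefl 0%:Z)) addr0 -[_ *+ size hs]mulr_natr natz -/N.
move: (\sum_(h <- hs) _)%N e2 => S.
by move: (\sum_(i < _) _)%N (supp (pi x)) (N * size p)%N; lia.
Qed.

Lemma riemann_hurwitz : (2 * N + \sum_i ram hs i 0 = N * size p + 2)%N.
Proof.
have := supp_image 0; rewrite raddf0; have [c0 _] := nf0 wq; have [c0' _] := nf0 wp.
rewrite [supp _]big1 => [|i _]; last by rewrite c0 eqxx.
by rewrite addn0; under eq_bigr do rewrite c0'.
Qed.

Lemma euler_image_addgen x i :
  euler (pi (x + gen i)) = euler (pi x) + (ram hs i (nf_coef (x + gen i) i))%:Z.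
Proof.
rewrite -!eulerK -sum_vanishing_ram // (big_morph Posz PoszD (erefl 0%:Z)).
rewrite -big_split /=; apply: eq_bigr => h _.
by rewrite addrAC euler_addgen.
Qed.

End Ramification.

(** * The standard form *)

(** The shape of a quotient map of weighted projective lines: there are r i points
    over the i-th exceptional point, all of ramification index e i and weight f i;
    J i lists those of them that are exceptional, and x_i is mapped to the sum of
    the classes of the points over it. A point of weight 1 has class the canonical
    element, and does not occur among the indices of q. *)
Record standard (p q : seq nat) (pi : {additive string_group p -> string_group q})
    (f e r : 'I_(size p) -> nat) (N : nat) (J : 'I_(size p) -> seq 'I_(size q)) :
    Prop := Standard {
  std_weight : forall i : 'I_(size p), weight p i = (e i * f i)%N;
  std_order : forall i : 'I_(size p), (r i * e i)%N = N;
  std_order_gt0 : (0 < N)%N;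
  std_partition : perm_eq (flatten [seq J i | i <- enum 'I_(size p)]) (enum 'I_(size q));
  std_size : forall i : 'I_(size p), size (J i) = (if f i == 1 then 0 else r i)%N;
  std_point_weight : forall (i : 'I_(size p)) (j : 'I_(size q)),
    j \in J i -> weight q j = f i;
  std_gen : forall i : 'I_(size p), pi (gen i) =
    if f i == 1%N then can_elt q *+ r i else \sum_(j <- J i) gen j;
  std_can : pi (can_elt p) = can_elt q *+ N }.

Lemma prE (p : seq nat) (i : 'I_(size p)) (x : string_group p) :
  weight_sequence p -> pr i x = (nf_coef x i)%:~R.
Proof.
move=> wp; rewrite /pr [in LHS](divz_eq ((string_repr x).1 0 i) (weight p i)%:Z).
rewrite rmorphD rmorphM /= -pmulrn pchar_Zp ?mulr0 ?add0r //.
exact: weight_gt1.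
Qed.

Lemma pr_eq1 (p : seq nat) (i : 'I_(size p)) (x : string_group p) :
  weight_sequence p -> pr i x = 1 -> nf_coef x i = 1.
Proof.
move=> wp; rewrite prE //; have w1 := weight_gt1 i wp.
have := nf_coef_range x i wp; case: (nf_coef x i) => // n /andP[_ nw].
rewrite -pmulrn => /(congr1 (@nat_of_ord _)); rewrite val_Zp_nat // modn_small //.
by have := val_Zp_nat w1 1; rewrite mulr1n modn_small // => -> ->.
Qed.

Lemma dvdz_mod_dvd (d w a : int) : (d %| w)%Z -> (d %| (a %% w)%Z)%Z = (d %| a)%Z.
Proof.
by move=> dw; rewrite [in RHS](divz_eq a w) [RHS](rpredDl _ (dvdz_mull _ dw)).
Qed.

Lemma modz_sum (I : Type) (s : seq I) (F : I -> int) (d : int) :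
  ((\sum_(i <- s) (F i %% d)%Z) %% d)%Z = ((\sum_(i <- s) F i) %% d)%Z.
Proof.
elim: s => [|i s IH]; first by rewrite !big_nil.
by rewrite !big_cons modzDml -modzDmr IH modzDmr.
Qed.

Section StandardForm.
Variables (p q : seq nat) (pi : {additive string_group p -> string_group q}).
Variable hs : seq (string_group p).
Hypotheses (wp : weight_sequence p) (wq : weight_sequence q).
Hypothesis (hsK : kernel_enum pi hs).
Hypothesis eulerK : forall x, \sum_(h <- hs) euler (x + h) = euler (pi x).
Variable f : 'I_(size p) -> nat.
Hypothesis f0 : forall i, (0 < f i)%N.
Hypothesis fP : forall i k,
  ram hs i k = if ((f i)%:Z %| k)%Z then ram hs i 0 else 0%N.

Local Notation r i := (ram hs i 0).
Local Notation W i j := (nf_coef (pi (gen i)) j).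
Local Notation J i := [seq j <- enum 'I_(size q) | W i j != 0].

Lemma f_dvd_weight i : (f i %| weight p i)%N.
Proof.
have := fP i (weight p i); have := ram0_gt0 wp hsK i.
rewrite {2}/ram (eq_count (a2 := fun h => ((weight p i)%:Z %| nf_coef h i + 0)%Z)).
  by rewrite -/(ram hs i 0) dvdzE /=; case: ifP => // _ + e; rewrite e.
by move=> h /=; rewrite addr0 rpredDr ?dvdzz.
Qed.

(** The difference of the formulas for x and for 0: a coefficient of x contributes
    all the r i points over its index i, unless f i divides it. *)
Lemma supp_branch x :
  (supp (pi x) = \sum_i if ((f i)%:Z %| nf_coef x i)%Z then 0 else ram hs i 0)%N.
Proof.
have := supp_image wp wq hsK eulerK x; have := riemann_hurwitz wp wq hsK eulerK.
have -> : (\sum_i ram hs i 0 = \sum_i ram hs i (nf_coef x i) +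
    \sum_i if ((f i)%:Z %| nf_coef x i)%Z then 0 else ram hs i 0)%N.
  rewrite -big_split /=; apply: eq_bigr => i _.
  by rewrite [in RHS]fP; case: ifP; rewrite ?addn0.
by lia.
Qed.

Lemma dvd_nf_coef_gen i k i' :
  ((f i')%:Z %| nf_coef (gen i *+ k) i')%Z = (i' != i) || (f i %| k)%N.
Proof.
rewrite nf_coefMn // dvdz_mod_dvd ?dvdzE ?f_dvd_weight //=.
have [-> _] := nf_gen i wp; have [->|ne] := eqVneq i' i; last by rewrite mul0r dvdn0.
by rewrite mul1r.
Qed.

Lemma supp_mulgen i k :
  supp (pi (gen i *+ k)) = (if (f i %| k)%N then 0 else r i)%N.
Proof.
rewrite supp_branch (bigD1 i) //= dvd_nf_coef_gen eqxx /= big1 ?addn0 //.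
by move=> i' ne; rewrite dvd_nf_coef_gen ne.
Qed.

Lemma image_coef_mul i k j :
  nf_coef (pi (gen i *+ k)) j = ((W i j * k%:Z) %% (weight q j)%:Z)%Z.
Proof. by rewrite raddfMn nf_coefMn. Qed.

Lemma image_coef_mul_eq0 i k j :
  (nf_coef (pi (gen i *+ k)) j == 0) = ((weight q j)%:Z %| W i j * k%:Z)%Z.
Proof. exact/nf_coef_eq0/image_coef_mul. Qed.

Lemma support_size i : size (J i) = (if f i == 1 then 0 else r i)%N.
Proof.
rewrite size_filter -sum1_count big_enum_cond big_mkcond /= -[f i == 1%N]dvdn1.
by rewrite -supp_mulgen mulr1n; apply: eq_bigr => j _; case: (_ != 0).
Qed.

(** Every coefficient of the image of x_i has order f i or 1: the support of
    the image of k x_i shrinks only by disappearing altogether. *)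
Lemma coef_order i j k : W i j != 0 ->
  ((weight q j)%:Z %| W i j * k%:Z)%Z = (f i %| k)%N.
Proof.
move=> Wij; rewrite -image_coef_mul_eq0; have := supp_mulgen i k.
case: ifP => [_ /eqP|nk e].
  by rewrite sum_nat_eq0 => /forallP/(_ j)/=; rewrite eqb0 negbK.
suff /(_ j) : forall j, nat_of_bool (nf_coef (pi (gen i *+ k)) j != 0) = (W i j != 0).
  by rewrite Wij; case: (_ == 0).
apply: sumn_leq_eq => [j'|].
  have [W0|_] := eqVneq (W i j') 0; last by case: (_ != 0).
  by rewrite image_coef_mul W0 mul0r mod0z eqxx.
rewrite -[LHS]/(supp _) -[RHS]/(supp _) e.
have := supp_mulgen i 1; rewrite mulr1n => ->.
by rewrite dvdn1; case: eqP => // fi1; move: nk; rewrite fi1 dvd1n.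
Qed.

Lemma W_neq0_f i j : W i j != 0 -> f i != 1%N.
Proof.
move=> Wij; apply/eqP => fi; have := coef_order 1 Wij; rewrite fi dvd1n mulr1.
by move/dvdz_mod0P; rewrite nf_coef_mod => /eqP; rewrite (negPf Wij).
Qed.

(** A common index would leave fewer than r i + r i' indices for the support of
    the image of x_i + x_i'. *)
Lemma supports_disjoint i i' j : W i j != 0 -> W i' j != 0 -> i = i'.
Proof.
move=> Wij Wi'j; apply/eqP/negPn/negP => ne.
suff : nat_of_bool (nf_coef (pi (gen i + gen i')) j != 0) =
    ((W i j != 0) + (W i' j != 0))%N.
  by rewrite Wij Wi'j; case: (_ != 0).
move: j {Wij Wi'j} (W_neq0_f Wij) (W_neq0_f Wi'j) => j fi fi'.
apply: (@sumn_leq_eq _ (fun j => nat_of_bool (nf_coef (pi (gen i + gen i')) j != 0))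
    (fun j => (W i j != 0) + (W i' j != 0))%N) => [j'|].
  rewrite raddfD nf_coefD //; have [->|_] := eqVneq (W i j') 0; last first.
    by case: (_ != 0); rewrite ?addn1 ?addn0.
  by rewrite add0r nf_coef_mod.
rewrite big_split /= -/(supp _) -[X in (X + _)%N]/(supp _) -[X in (_ + X)%N]/(supp _).
have si k : f k != 1%N -> supp (pi (gen k)) = r k.
  by move=> fk; rewrite -[gen k]mulr1n supp_mulgen dvdn1 (negPf fk).
have ni (k k' : 'I_(size p)) : nf_coef (gen k + gen k') =1
    fun l => (((l == k) + (l == k'))%:Z %% (weight p l)%:Z)%Z.
  by move=> l; rewrite nf_coefD //; have [-> _] := nf_gen k wp; have [-> _] := nf_gen k' wp.
have ii' : (i' == i) = false by rewrite eq_sym (negPf ne).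
have nd k : f k != 1%N -> ((f k)%:Z %| (1 %% (weight p k)%:Z)%Z)%Z = false.
  by move=> fk; rewrite dvdz_mod_dvd ?dvdzE ?f_dvd_weight //= dvdn1 (negPf fk).
rewrite !si // supp_branch (bigD1 i) //= (bigD1 i') ?ii' //= !ni !eqxx ii' (negPf ne).
rewrite !nd // big1 ?addn0 // => l /andP[/negPf li /negPf li'].
by rewrite ni li li' mod0z dvdz0.
Qed.

Lemma image_can : pi (can_elt p) = can_elt q *+ size hs.
Proof.
have ce x k : nf_coef (x + can_elt p *~ k) =1 nf_coef x by move=> i; apply: nf_coef_addc.
apply: nf_coef_inj => // [j|]; rewrite pmulrn; have [c1 c2] := nf_mulrz_can (size hs) wq.
  rewrite c1; apply/eqP/negPn/negP => nz.
  suff : supp (pi (can_elt p)) = 0%N by rewrite /supp (bigD1 j) //= nz.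
  rewrite supp_branch big1 // => i _.
  by have := ce 0 1 i; rewrite add0r mulr1z => ->; have [-> _] := nf0 wp; rewrite dvdz0.
rewrite c2; have := eulerK (can_elt p); rewrite -[can_elt p]mulr1z.
under eq_bigr do rewrite addrC euler_addc //.
rewrite big_split /= big_const_seq count_predT iter_addr addr0 -[_ *+ _]mulr_natl natz mulr1.
have -> : \sum_(h <- hs) euler h = 1.
  by have := eulerK 0; rewrite raddf0 euler0 //; under eq_bigr do rewrite add0r.
by rewrite /euler; lia.
Qed.

(** Every exceptional point lies in the support of exactly one x_i, and
    effectivity makes the coefficient there a generator; being of order f i,
    it forces the weight of the point to be f i. *)
Lemma point_weight j : effective (range pi) ->
  exists2 i, W i j != 0 & weight q j = f i.
Proof.
move=> [_ _ _ eff].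
have [_ [x _ <-]] : (pr j @` range pi)%classic 1 by rewrite eff.
move=> /(pr_eq1 wq) x1.
have cx : nf_coef (pi x) j = ((\sum_i W i j * nf_coef x i) %% (weight q j)%:Z)%Z.
  have [_ {1}->] := normal_form x wp.
  rewrite raddfD [X in _ + X]raddfMz image_can pmulrn -mulrzA nf_coef_addc //.
  rewrite raddf_sum nf_coef_sum // -[RHS]modz_sum.
  congr (_ %% _)%Z; apply: eq_bigr => i _.
  by rewrite raddfMz nf_coefMz.
have [i Wij|none] := pickP (fun i => W i j != 0); last first.
  move: x1; rewrite cx big1 ?mod0z // => i _.
  by have /negbFE/eqP-> := none i; rewrite mul0r.
exists i => //; move: cx; rewrite x1 (bigD1 i) //= big1 ?addr0; last first.
  move=> i' ne; have [->|Wi'j] := eqVneq (W i' j) 0; first by rewrite mul0r.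
  by rewrite (supports_disjoint Wij Wi'j) eqxx in ne.
set a := nf_coef x i => e1.
have wk (k : nat) : (weight q j %| k)%N = (f i %| k)%N.
  rewrite -(coef_order k Wij); apply/idP/idP => [d|d].
    by apply: dvdz_mull; rewrite dvdzE.
  have : ((weight q j)%:Z %| a * (W i j * k%:Z))%Z by apply: dvdz_mull.
  rewrite mulrA [a * _]mulrC (sameP dvdz_mod0P eqP) -modzMml -e1 mul1r.
  by rewrite -(sameP dvdz_mod0P eqP) dvdzE.
by apply/eqP; rewrite eqn_dvd wk dvdnn -wk dvdnn.
Qed.

Lemma euler_image_mulgen i k : euler (pi (gen i *+ k)) = 1 + (r i * (k %/ f i))%:Z.
Proof.
elim: k => [|k IH]; first by rewrite mulr0n raddf0 div0n muln0 addr0 euler0.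
rewrite mulrSr (euler_image_addgen wp eulerK) IH -[_ *+ k + gen i]mulrSr divnS //.
rewrite [ram hs i (nf_coef _ _)]fP.
have := dvd_nf_coef_gen i k.+1 i; rewrite eqxx /= => ->.
by case: (_ %| _)%N; lia.
Qed.

(** The Euler characteristic of the image of f i x_i says that the coefficients on
    J i, which are positive, add up to their number; so they are all 1. *)
Lemma image_gen_branch i : (forall j, W i j != 0 -> weight q j = f i) -> f i != 1%N ->
  pi (gen i) = \sum_(j <- J i) gen j.
Proof.
move=> wJ fi.
have can0 : nf_can (pi (gen i)) = 0.
  have := euler_image_mulgen i 1; rewrite mulr1n divn_small; last by have := f0 i; lia.
  by rewrite muln0 /euler; lia.
have [_ e] := normal_form (pi (gen i)) wq; rewrite can0 mulr0z addr0 in e.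
have ef : pi (gen i *+ f i) = can_elt q *~ \sum_j W i j.
  rewrite raddfMn [X in X *+ _ = _]e -sumrMnl mulrz_sumr; apply: eq_bigr => j _.
  have [->|Wij] := eqVneq (W i j) 0; first by rewrite !mulr0z mul0rn.
  by rewrite -(wJ j Wij) pmulrn -mulrzA mulrC mulrzA -pmulrn gen_weight.
have sumW : \sum_j W i j = (r i)%:Z.
  have := euler_image_mulgen i (f i); rewrite ef divnn f0 muln1.
  by rewrite -[_ *~ _]add0r euler_addc // euler0 //; lia.
have W01 j : W i j = (W i j != 0)%:Z.
  have Wpos k : 0 <= W i k by have /andP[] := nf_coef_range (pi (gen i)) k wq.
  have : nat_of_bool (W i j != 0) = `|W i j|%N.
    apply: (sumn_leq_eq (a := fun j => nat_of_bool (W i j != 0)) (b := fun j => `|W i j|%N)).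
      by move=> k; case: eqP => //; lia.
    rewrite -[LHS]/(supp _) -[gen i]mulr1n supp_mulgen dvdn1 (negPf fi) mulr1n.
    apply/eqP; rewrite -eqz_nat -sumW (big_morph Posz PoszD (erefl 0%:Z)) /=.
    by apply/eqP/eq_bigr => k _; rewrite gez0_abs.
  by move=> ->; rewrite gez0_abs.
rewrite [LHS]e big_filter big_enum_cond [RHS]big_mkcond; apply: eq_bigr => j _ /=.
by rewrite [X in _ *~ X]W01; case: (_ != 0).
Qed.

Lemma image_gen_unbranched i : f i = 1%N -> pi (gen i) = can_elt q *+ r i.
Proof.
move=> fi; have W0 j : W i j = 0.
  by apply/eqP/negPn/negP => /W_neq0_f; rewrite fi.
apply: nf_coef_inj => // [j|]; rewrite pmulrn; have [c1 c2] := nf_mulrz_can (r i) wq.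
  by rewrite c1.
by rewrite c2; have := euler_image_mulgen i 1; rewrite mulr1n fi divn1 muln1 /euler; lia.
Qed.

Lemma standard_form : effective (range pi) ->
  standard pi f (fun i => weight p i %/ f i)%N (fun i => r i) (size hs) (fun i => J i).
Proof.
move=> eff.
have wJ i j : W i j != 0 -> weight q j = f i.
  move=> Wij; have [i' Wi'j ->] := point_weight j eff.
  by rewrite (supports_disjoint Wij Wi'j).
have wf (i : 'I_(size p)) : weight p i = (weight p i %/ f i * f i)%N.
  by rewrite divnK ?f_dvd_weight.
split=> //.
- move=> i; have := euler_image_mulgen i (weight p i).
  rewrite gen_weight image_can pmulrn -[_ *~ _]add0r euler_addc // euler0 //.
  by lia.
- exact: (kernel_size_gt0 hsK).
- have count_enum (T : finType) (P : pred T) (j : T) :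
      count_mem j [seq k <- enum T | P k] = P j.
    rewrite count_uniq_mem; last exact/filter_uniq/enum_uniq.
    by rewrite mem_filter mem_enum andbT.
  apply/allP => j _; apply/eqP.
  rewrite [RHS]count_uniq_mem ?enum_uniq // mem_enum count_flatten sumnE !big_map.
  have [i Wij _] := point_weight j eff.
  rewrite -enumT big_enum (bigD1 i) // count_enum Wij big1 // => i' ne.
  rewrite count_enum; have [//|Wi'j] := eqVneq (W i' j) 0.
  by rewrite (supports_disjoint Wij Wi'j) eqxx in ne.
- exact: support_size.
- by move=> i j; rewrite mem_filter => /andP[+ _]; apply: wJ.
- move=> i; have [fi|fi] := eqVneq (f i) 1%N; first exact: image_gen_unbranched.
  by apply: image_gen_branch => // j; apply: wJ.
- exact: image_can.
Qed.

End StandardForm.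

(** * Abelian groups acting on a curve of genus 0 *)

(** The ramification data of the finite abelian groups of automorphisms of the
    projective line: a cyclic group of order N has two fixed points, and a Klein
    four-group has three orbits with stabilisers of order 2. *)
Definition cyclic_ramification (I : eqType) (e : I -> nat) (N : nat) (i j : I) : Prop :=
  i != j /\ forall k, e k = if k \in [:: i; j] then N else 1%N.

Definition klein_ramification (I : eqType) (e : I -> nat) (N : nat) (i j k : I) : Prop :=
  [/\ N = 4, uniq [:: i; j; k] & forall l, e l = if l \in [:: i; j; k] then 2 else 1]%N.

(** By Riemann-Hurwitz the sum of the 1 - 1/e i is 2 - 2/N < 2, which leaves
    two or three ramified indices; two must both have e = N. With three, the
    last hypothesis excludes the non-abelian polyhedral groups: substituting
    r j, r k <= e i in the formula gives (r i - 2)(e i - 1) <= 0 for each i. *)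
Lemma genus0_abelian_ramification (I : finType) (e r : I -> nat) (N : nat) :
  (1 < N)%N -> (forall i, r i * e i = N)%N ->
  (2 * N + \sum_i r i = N * #|I| + 2)%N ->
  (forall i j k, uniq [:: i; j; k] -> (forall l, l \notin [:: i; j; k] -> e l = 1%N) ->
     r i <= e j)%N ->
  (exists i j, cyclic_ramification e N i j) \/
  (exists i j k, klein_ramification e N i j k).
Proof.
move=> N1 re RH bound.
pose B := [seq i <- enum I | e i != 1%N].
have uB : uniq B by rewrite filter_uniq // enum_uniq.
have eB l : l \notin B -> e l = 1%N.
  by rewrite mem_filter mem_enum andbT negbK => /eqP.
have Be l : l \in B -> (r l * 2 <= N)%N /\ (0 < r l)%N.
  rewrite mem_filter => /andP[/eqP el _]; have := re l.
  by case: (e l) el => [|[|m]] //; [rewrite muln0; lia | nia].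
have RHB : (\sum_(i <- B) (N - r i) = 2 * N - 2)%N.
  have : (\sum_i (N - r i) = 2 * N - 2)%N.
    rewrite sumnB => [|i _].
      rewrite sum_nat_const mulnC -[LHS]/(N * #|I| - _)%N.
      by move: RH; move: (N * #|I|)%N (\sum_i r i)%N => a b; lia.
    by have := re i; case: (e i) => [|m]; [rewrite muln0; lia | nia].
  rewrite (bigID (fun i => e i != 1%N)) /= [X in (_ + X)%N]big1 ?addn0.
    by rewrite big_filter big_enum_cond.
  by move=> i /negPn/eqP ei; have := re i; rewrite ei; lia.
have low : (size B * N <= 2 * (2 * N - 2))%N.
  rewrite -RHB big_distrr /= -sum1_size big_distrl /= big_seq [leqRHS]big_seq.
  by apply: leq_sum => i /Be[]; lia.
have up : (2 * N - 2 <= size B * (N - 1))%N.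
  rewrite -RHB -sum1_size big_distrl /= big_seq [leqRHS]big_seq.
  by apply: leq_sum => i /Be[]; lia.
have sB : size B = 2 \/ size B = 3 by move: low up; case: (size B) => [|[|[|[|n]]]]; nia.
case: B uB eB Be RHB sB {low up} => [|i [|j [|k [|]]]] //=; try by move=> *; lia.
  rewrite inE andbT => ij eB Be; rewrite !big_cons big_nil => RHB _; left; exists i, j.
  have [Ni ri] := Be i (mem_head _ _); have [Nj rj] : (r j * 2 <= N /\ 0 < r j)%N.
    by apply: Be; rewrite !inE eqxx orbT.
  split=> // l; case: ifP => [|/negbT]; last exact: eB.
  rewrite !inE => /orP[]/eqP->.
    by have := re i; rewrite (_ : r i = 1%N) ?mul1n //; lia.
  by have := re j; rewrite (_ : r j = 1%N) ?mul1n //; lia.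
move=> uB eB Be; rewrite !big_cons big_nil => RHB _; right; exists i, j, k.
have iB : i \in [:: i; j; k] by rewrite inE eqxx.
have jB : j \in [:: i; j; k] by rewrite !inE eqxx orbT.
have kB : k \in [:: i; j; k] by rewrite !inE eqxx !orbT.
have bd x y z : perm_eq [:: x; y; z] [:: i; j; k] -> (r x <= e y)%N.
  move=> pm; apply: (bound x y z); first by rewrite (perm_uniq pm).
  by move=> l; rewrite (perm_mem pm); apply: eB.
have bij : (r i <= e j)%N by apply: (bd i j k).
have bik : (r i <= e k)%N by apply: (bd i k j); apply/permP => a /=; lia.
have bji : (r j <= e i)%N by apply: (bd j i k); apply/permP => a /=; lia.
have bjk : (r j <= e k)%N by apply: (bd j k i); apply/permP => a /=; lia.
have bki : (r k <= e i)%N by apply: (bd k i j); apply/permP => a /=; lia.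
have bkj : (r k <= e j)%N by apply: (bd k j i); apply/permP => a /=; lia.
have [[Ni ri] [Nj rj] [Nk rk]] := And3 (Be i iB) (Be j jB) (Be k kB).
have sum : (r i + r j + r k = N + 2)%N by lia.
move: (re i) (re j) (re k) => Ei Ej Ek.
have le2 a b c ea : (a * ea = N -> a * 2 <= N -> 0 < a -> b <= ea -> c <= ea ->
    a + b + c = N + 2 -> a <= 2)%N by nia.
have := le2 _ (r j) (r k) _ Ei Ni ri bji bki sum.
have := le2 _ (r i) (r k) _ Ej Nj rj bij bkj ltac:(lia).
have := le2 _ (r i) (r j) _ Ek Nk rk bik bjk ltac:(lia).
move=> rk2 rj2 ri2.
have N4 : N = 4%N by move: Ei Ej Ek ri2 rj2 rk2 sum; nia.
split=> // l; case: ifP => [|/negbT]; last exact: eB.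
by rewrite !inE => /or3P[]/eqP->; move: Ei Ej Ek; nia.
Qed.

(** Translation by a kernel element permutes the kernel, so it cannot change the
    sum of the degrees. *)
Lemma kernel_degree0 (p q : seq nat)
    (pi : {additive string_group p -> string_group q}) (hs : seq (string_group p))
    (deg : {additive string_group p -> rat}) h :
  kernel_enum pi hs -> h \in hs -> deg h = 0.
Proof.
move=> hsK hin.
have : \sum_(g <- hs) deg (g + h) = \sum_(g <- hs) deg g.
  by rewrite -[RHS](perm_big _ (kernel_shift hsK hin)) big_map.
under eq_bigr do rewrite raddfD.
rewrite big_split /= big_const_seq count_predT iter_addr addr0 -[RHS]addr0.
move/addrI/eqP; rewrite mulrn_eq0 => /orP[/nilP|/eqP//].
by move=> hs0; rewrite hs0 in hin.
Qed.

(** The degree of such an x differs from nf_coef x k / p_k, which is less than 1, by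
    an integer; so both are 0. *)
Lemma torsion_coef_inj (p : seq nat) (deg : {additive string_group p -> rat})
    (x : string_group p) (k : 'I_(size p)) :
  weight_sequence p ->
  (forall x, deg x = \sum_i (nf_coef x i)%:~R / (weight p i)%:R + (nf_can x)%:~R) ->
  deg x = 0 -> (forall i, i != k -> nf_coef x i = 0) -> x = 0.
Proof.
move=> wp degE; rewrite degE => dx cx.
have w0 : (weight p k)%:R != 0 :> rat by rewrite pnatr_eq0 -lt0n weight_gt0.
move: dx; rewrite (bigD1 k) //= big1 ?addr0 => [dx|i /cx->]; last by rewrite mul0r.
have e : nf_coef x k + nf_can x * (weight p k)%:Z = 0.
  apply/eqP; rewrite -(intr_eq0 rat) rmorphD rmorphM /=.
  by rewrite -[X in X == 0](divfK w0) mulrDl mulfK // dx mul0r.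
have [c1 c2] := nf0 wp; have w1 := weight_gt1 k wp;
have := nf_coef_range x k wp => /andP[x0 xw].
have xc : nf_can x = 0.
  by move: e x0 xw; move: (nf_coef x k) (nf_can x) (weight p k)%:Z => a c w; nia.
have xk : nf_coef x k = 0 by rewrite xc in e; lia.
apply: nf_coef_inj => // [i|]; last by rewrite xc c2.
by rewrite c1; have [->|/cx] := eqVneq i k.
Qed.

(** For the bound r i <= e j: among the kernel elements vanishing at i, at most
    e j different coefficients occur at j, as these are multiples of f j; and if
    nothing ramifies outside i, j and k, then two such elements that agree at j
    differ by a torsion element supported at k, which is 0. *)
Lemma admissible_standard (p q : seq nat)
    (pi : {additive string_group p -> string_group q}) :
  weight_sequence p -> weight_sequence q -> admissible pi ->
  (exists2 x, x != 0 & pi x = 0) ->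
  exists f e r N J, [/\ standard pi f e r N J, (1 < N)%N &
    (exists i j, cyclic_ramification e N i j) \/
    (exists i j k, klein_ramification e N i j k)].
Proof.
move=> wp wq adm [x x0 px]; have [hs hsK] := admissible_kernel wp adm.
have eulerK := euler_sum_kernel wp wq adm hsK.
have /fin_all_exists[f /all_and2[f0 fP]] : forall i, exists fi : nat, (0 < fi)%N /\
    forall k, ram hs i k = if (fi%:Z %| k)%Z then ram hs i 0 else 0%N.
  by move=> i; have [fi] := ramP wp hsK i; exists fi.
have st := standard_form wp wq hsK eulerK f0 fP adm.1.
exists f, (fun i : 'I_(size p) => weight p i %/ f i)%N, (fun i => ram hs i 0), (size hs).
exists (fun i => [seq j <- enum 'I_(size q) | nf_coef (pi (gen i)) j != 0]).
have N1 : (1 < size hs)%N.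
  have := @uniq_leq_size _ [:: 0; x] hs; rewrite /= inE eq_sym x0 /=; apply=> //.
  by move=> y; rewrite !inE (kernel_enumP hsK) => /orP[]/eqP->; rewrite ?raddf0 ?px.
split=> //; apply: (genus0_abelian_ramification N1 (std_order st)).
  by rewrite card_ord; apply: (riemann_hurwitz wp wq hsK eulerK).
have [deg degE] := degree_exists wp.
move=> i j k uijk e1.
pose A := [seq h <- hs | nf_coef h i == 0].
have rA : ram hs i 0 = size A.
  rewrite size_filter; apply: eq_count => h /=; rewrite addr0.
  by rewrite (sameP dvdz_mod0P eqP) nf_coef_mod.
have fd h l : h \in hs -> ((f l)%:Z %| nf_coef h l)%Z.
  move=> hin; have := fP l (- nf_coef h l); rewrite rpredN; case: (_ %| _)%Z => // e.
  have : (0 < ram hs l (- nf_coef h l))%N.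
    by rewrite -has_count; apply/hasP; exists h; rewrite ?subrr ?dvdz0.
  by rewrite e.
pose g h := (`|nf_coef h j| %/ f j)%N.
rewrite rA -(size_map g) -(size_iota 0 (weight p j %/ f j)).
apply: uniq_leq_size => [|_ /mapP[h hA ->]]; last first.
  rewrite mem_iota add0n /= ltn_divLR // divnK ?(f_dvd_weight wp hsK fP) //.
  have /andP[a b] := nf_coef_range h j wp.
  by rewrite -ltz_nat gez0_abs.
rewrite map_inj_in_uniq ?filter_uniq ?(kernel_enum_uniq hsK) // => h h'.
rewrite !mem_filter => /andP[/eqP hi hin] /andP[/eqP hi' hin'] ghh'.
have hj : nf_coef h j = nf_coef h' j.
  have := fd h j hin; have := fd h' j hin'; rewrite !dvdzE /= => d' d.
  have := congr1 (muln^~ (f j)) ghh'; rewrite /g !divnK // => /(congr1 Posz).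
  have n0 y : 0 <= nf_coef y j by case/andP: (nf_coef_range y j wp).
  by rewrite !gez0_abs.
apply/eqP; rewrite -subr_eq0; apply/eqP; apply: (torsion_coef_inj (k := k) wp degE).
  by rewrite raddfB !(kernel_degree0 deg hsK) // subrr.
have eq0 l : nf_coef h l = nf_coef h' l -> nf_coef (h - h') l = 0.
  by move=> e; rewrite nf_coefD // nf_coefN // modzDmr e subrr mod0z.
move=> l lk; apply: eq0; have [->|li] := eqVneq l i; first by rewrite hi hi'.
have [->//|lj] := eqVneq l j.
have fl : f l = weight p l.
  by rewrite (std_weight st) e1 ?mul1n // !inE negb_or li negb_or lj lk.
have z y : y \in hs -> nf_coef y l = 0.
  by move=> /(fd y l); rewrite fl => /dvdz_mod0P; rewrite nf_coef_mod.
by rewrite !z.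
Qed.

(** * Recognising admissible homomorphisms *)

Lemma modz_modr (d w a : int) : (d %| w)%Z -> ((a %% w)%Z %% d)%Z = (a %% d)%Z.
Proof.
move=> dw; rewrite [in RHS](divz_eq a w) -[RHS]modzDml.
by have /dvdz_mod0P-> := dvdz_mull (a %/ w)%Z dw; rewrite add0r.
Qed.

Lemma nf_coef_sum_gen (p : seq nat) (s : seq 'I_(size p)) (j : 'I_(size p)) :
  weight_sequence p ->
  nf_coef (\sum_(k <- s) gen k) j = ((count_mem j s)%:Z %% (weight p j)%:Z)%Z.
Proof.
move=> wp; rewrite nf_coef_sum // -sum1_count (big_morph Posz PoszD (erefl 0%:Z)).
rewrite [in RHS]big_mkcond; congr (_ %% _)%Z; apply: eq_bigr => k _ /=.
by have [-> _] := nf_gen k wp; rewrite eq_sym; case: eqP.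
Qed.

Lemma euler_add_gens (p : seq nat) (x : string_group p) (s : seq 'I_(size p)) :
  weight_sequence p -> uniq s ->
  euler (x + \sum_(k <- s) gen k) =
  euler x + \sum_(k <- s) (nf_coef (x + gen k) k == 0)%:Z.
Proof.
move=> wp; elim: s x => [|k s IH] x /=; first by rewrite !big_nil !addr0.
move=> /andP[ks us]; rewrite !big_cons !addrA IH // euler_addgen //; congr (_ + _).
rewrite big_seq [RHS]big_seq; apply: eq_bigr => l ls; congr (nat_of_bool _)%:Z.
rewrite addrAC (nf_coefD _ (gen k)) //; have [-> _] := nf_gen k wp.
by rewrite (negPf (memPn ks l ls)) addr0 nf_coef_mod.
Qed.

Lemma additive_eq_gen (p : seq nat) (A : zmodType)
    (g g' : {additive string_group p -> A}) :
  (0 < size p)%N -> (forall i, g (gen i) = g' (gen i)) -> g =1 g'.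
Proof.
move=> p0 gg'; apply: string_group_ind_gen => // [|x i]; first by rewrite !raddf0.
by rewrite !raddfD gg'; split=> [->|/addIr].
Qed.

Lemma torsion_euler_le0 (p : seq nat) (x : string_group p) (M : nat) :
  weight_sequence p -> (0 < M)%N -> x *+ M = 0 -> x != 0 -> euler x <= 0.
Proof.
move=> wp M0 xM; apply: contraNT; rewrite -ltNge /euler => x0.
have [deg degE] := degree_exists wp.
have : deg x = 0.
  have := congr1 deg xM; rewrite raddfMn raddf0 => /eqP.
  by rewrite mulrn_eq0 eqn0Ngt M0 => /eqP.
have w0 (i : 'I_(size p)) : 0 < (weight p i)%:R :> rat by rewrite ltr0n weight_gt0.
have ge0 (i : 'I_(size p)) : 0 <= (nf_coef x i)%:~R / (weight p i)%:R :> rat.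
  by rewrite divr_ge0 ?ler0z ?(ltW (w0 _)) //; case/andP: (nf_coef_range x i wp).
have can0 : 0 <= (nf_can x)%:~R :> rat by rewrite ler0z; lia.
rewrite degE => /eqP; rewrite paddr_eq0 ?sumr_ge0 // => /andP[/eqP s0 c0].
have [c1 c2] := nf0 wp; apply/eqP; apply: nf_coef_inj => // [i|].
  have /(_ i isT)/eqP := psumr_eq0P (fun i _ => ge0 i) s0.
  by rewrite mulf_eq0 invr_eq0 (gt_eqF (w0 _)) orbF intr_eq0 c1 => /eqP.
by apply/eqP; rewrite c2 -(intr_eq0 rat).
Qed.

Section Recognition.
Variables (p q : seq nat) (pi : {additive string_group p -> string_group q}).
Variables (f e r : 'I_(size p) -> nat) (N : nat) (J : 'I_(size p) -> seq 'I_(size q)).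
Hypotheses (wp : weight_sequence p) (wq : weight_sequence q).
Hypothesis (st : standard pi f e r N J).

Lemma std_count_sum j : (\sum_i count_mem j (J i) = 1)%N.
Proof.
have /permP/(_ (pred1 j)) := std_partition st.
rewrite count_flatten sumnE !big_map [RHS]count_uniq_mem ?enum_uniq // mem_enum.
by rewrite -enumT big_enum.
Qed.

Lemma std_mem_exists j : exists i, j \in J i.
Proof.
have [i ji|none] := pickP (fun i => j \in J i); first by exists i.
by have := std_count_sum j; rewrite big1 // => i _; apply/count_memPn; rewrite none.
Qed.

Lemma std_count i j k : j \in J i -> count_mem j (J k) = (k == i).
Proof.
rewrite -has_pred1 has_count => ji; have := std_count_sum j.
rewrite (bigD1 i) //; have [->|ki] := eqVneq k i; last rewrite (bigD1 k) //.
  by move: ji; case: (count_mem j (J i)) => [|[|n]].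
by move: ji; case: (count_mem j (J i)) => [|[|n]] //; case: (count_mem j (J k)).
Qed.

Lemma std_uniq i : uniq (J i).
Proof.
by apply: count_mem_uniq => j; have [/std_count->|/count_memPn->//] := boolP (j \in J i);
   rewrite eqxx.
Qed.

Lemma std_coef i j x : j \in J i -> nf_coef (pi x) j = (nf_coef x i %% (f i)%:Z)%Z.
Proof.
move=> ji; have wj := std_point_weight st ji.
have [_ {1}->] := normal_form x wp.
rewrite raddfD [X in _ + X]raddfMz (std_can st) pmulrn -mulrzA nf_coef_addc //.
rewrite raddf_sum nf_coef_sum // wj (bigD1 i) //= raddfMz big1 => [|k ki].
  rewrite addr0 nf_coefMz // wj modz_mod (std_gen st) ifN; last first.
    by apply/eqP => fi; have := std_size st i; rewrite fi; case: (J i) ji.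
  by rewrite nf_coef_sum_gen // (std_count _ ji) eqxx wj modzMml mul1r.
rewrite raddfMz nf_coefMz // (std_gen st).
case: ifP => _; last first.
  by rewrite nf_coef_sum_gen // (std_count _ ji) (negPf ki) mod0z mul0r mod0z.
by have [-> _] := nf_mulrz_can (r k) wq; rewrite mul0r mod0z.
Qed.

Lemma std_euler_addgen x i :
  euler (pi (x + gen i)) =
  euler (pi x) + (if ((f i)%:Z %| nf_coef (x + gen i)%R i)%Z then r i else 0%N)%:Z.
Proof.
rewrite raddfD [pi (gen i)](std_gen st); have := std_size st i; case: eqP => [fi _|fi sJ].
  by rewrite pmulrn euler_addc // fi dvd1z.
rewrite euler_add_gens ?std_uniq // -sJ; congr (_ + _).
have fw : (f i %| weight p i)%N by rewrite (std_weight st) dvdn_mull.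
have E j : j \in J i ->
    (nf_coef (pi x + gen j) j == 0) = ((f i)%:Z %| nf_coef (x + gen i)%R i)%Z.
  move=> ji; rewrite !nf_coefD // (std_point_weight st ji) (std_coef _ ji) modzDml.
  rewrite dvdz_mod_dvd ?dvdzE //.
  have [-> _] := nf_gen i wp; have [-> _] := nf_gen j wq; rewrite !eqxx.
  by rewrite -(sameP dvdz_mod0P eqP).
rewrite big_seq (eq_bigr (fun=> (((f i)%:Z %| nf_coef (x + gen i)%R i)%Z)%:Z)) => [|j /E->//].
rewrite -big_seq -(big_morph Posz PoszD (erefl 0%:Z)) big_const_seq count_predT.
by rewrite iter_addn_0; case: (_ %| _)%Z; rewrite ?mul1n ?mul0n.
Qed.

Variable hs : seq (string_group p).
Hypothesis p0 : (0 < size p)%N.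
Hypothesis uhs : uniq hs.
Hypothesis hs0 : 0 \in hs.
Hypothesis hs_euler : forall h, h \in hs -> h != 0 -> euler h = 0.
Hypothesis hs_ram : forall i k, ram hs i k = if ((f i)%:Z %| k)%Z then r i else 0%N.
Hypothesis hs_ker : forall h, h \in hs -> pi h = 0.

(** Both sides have the same increments along the generators x_i, and both are
    1 at 0. *)
Lemma recognition_euler x : \sum_(h <- hs) euler (x + h) = euler (pi x).
Proof.
elim/string_group_ind_gen: x => // [|x i].
  rewrite raddf0 euler0 // (bigD1_seq 0) //= addr0 euler0 // big_seq_cond big1 ?addr0 //.
  by move=> h /andP[hin h0]; rewrite add0r hs_euler.
rewrite std_euler_addgen -hs_ram -sum_vanishing_ram // (big_morph Posz PoszD (erefl 0%:Z)).
have -> : \sum_(h <- hs) euler (x + gen i + h) =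
   \sum_(h <- hs) euler (x + h) + \sum_(h <- hs) (nf_coef (x + gen i + h) i == 0)%:Z.
  by rewrite -big_split; apply: eq_bigr => h _; rewrite addrAC euler_addgen.
by split=> [->|/addIr].
Qed.

Lemma recognition_torsion x : pi x = 0 -> x != 0 -> euler x <= 0.
Proof.
move=> px; have [M M0 /(_ x)[m xM]] := common_order wp.
apply: (torsion_euler_le0 wp M0); rewrite xM.
suff -> : m = 0 by rewrite mulr0z.
have := congr1 pi xM; rewrite raddfMn px mul0rn raddfMz (std_can st) pmulrn -mulrzA.
move=> /esym/(congr1 (@nf_can q)); have [_ ->] := nf_mulrz_can (N%:Z * m) wq.
have [_ ->] := nf0 wq; move/eqP; rewrite mulf_eq0 => /orP[|/eqP//].
by have := std_order_gt0 st; case: N.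
Qed.

(** If x lies in the kernel but not in hs, all Euler characteristics in the sum
    at - x are those of nonzero torsion elements, hence at most 0, while the
    sum is 1. *)
Lemma recognition_kernel : kernel_enum pi hs.
Proof.
split=> // x; apply/idP/eqP => [/hs_ker//|px]; apply/negPn/negP => xhs.
have := recognition_euler (- x); rewrite raddfN /= px oppr0 euler0 //.
apply/eqP; rewrite lt_eqF // (@le_lt_trans _ _ 0) //.
rewrite big_seq sumr_le0 // => h hin; apply: recognition_torsion.
  by rewrite raddfD raddfN /= px oppr0 add0r hs_ker.
by rewrite addrC subr_eq0; apply: contraNneq xhs => <-.
Qed.

Lemma recognition_effective : effective (range pi).
Proof.
split.
- by exists 0 => //; rewrite raddf0.
- by move=> _ _ [x _ <-] [y _ <-]; exists (x - y) => //; rewrite raddfB.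
- move=> fin; apply: infinite_nat.
  have -> : [set: nat]%classic =
      ((fun k : nat => pi (can_elt p *+ k)) @^-1` range pi)%classic.
    by apply/seteqP; split=> // k _; exists (can_elt p *+ k).
  apply: finite_preimage => // k k' _ _ /=.
  rewrite !raddfMn /= (std_can st) -!mulrnA !pmulrn => /(congr1 (@nf_can q)).
  have [_ ->] := nf_mulrz_can (N * k)%N wq; have [_ ->] := nf_mulrz_can (N * k')%N wq.
  by have := std_order_gt0 st; move=> N0 [/eqP]; rewrite eqn_pmul2l // => /eqP.
- move=> j; apply/seteqP; split=> // v _; have [i ji] := std_mem_exists j.
  exists (pi (gen i *+ v)); first by exists (gen i *+ v).
  have w1 := weight_gt1 j wq.
  have vw : (v < weight q j)%N by rewrite -[X in (_ < X)%N](Zp_cast w1).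
  rewrite prE // (std_coef _ ji) nf_coefMn //.
  rewrite modz_modr; last by rewrite dvdzE (std_weight st) dvdn_mull.
  have [-> _] := nf_gen i wp; rewrite eqxx mul1r -(std_point_weight st ji).
  by rewrite modz_small ?ltz_nat // -pmulrn natr_Zp.
Qed.

(** Superadditivity and nf_can >= - 1 on the kernel prevent the Euler
    characteristics along a fibre from taking both signs, so that taking
    positive parts commutes with the summation. *)
Lemma recognition : kernel_enum pi hs /\ admissible pi.
Proof.
have hsK := recognition_kernel; split=> //; split; first exact: recognition_effective.
move=> _ [x _ <-]; rewrite (fibre_mult_sum _ hsK) mult_euler -recognition_euler.
have [/hasP[h hin hx]|/hasPn none] := boolP (has (fun h => 0 < euler (x + h)) hs).
  have pos g : g \in hs -> 0 <= euler (x + g).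
    move=> gin; have := nf_can_superadditive (x + h) (g - h) wp.
    rewrite [x + h + _]addrACA subrr addr0.
    have : 0 <= euler (g - h).
      have [->|gh] := eqVneq (g - h) 0; first by rewrite euler0.
      by rewrite hs_euler // (kernel_enumP hsK) raddfB !hs_ker // subrr.
    by move: hx; rewrite /euler; move: (nf_can (x + h)) (nf_can (g - h)) (nf_can (x + g)); lia.
  rewrite max_l; last by rewrite big_seq sumr_ge0.
  by rewrite big_seq [RHS]big_seq; apply: eq_bigr => g /pos ge0; rewrite mult_euler max_l.
have neg g : g \in hs -> euler (x + g) <= 0 by move=> /none; rewrite -leNgt.
rewrite max_r; last by rewrite big_seq sumr_le0.
by rewrite big_seq big1 // => g /neg le0; rewrite mult_euler max_r.
Qed.

End Recognition.

(** * Cyclic and Klein kernels *)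

(** If f divides m then exactly one of the N multiples of f below N f is
    congruent to - m modulo N f. *)
Lemma count_multiples (N f : nat) (m : int) : (0 < N)%N -> (0 < f)%N ->
  count (fun k => ((N * f)%N%:Z %| (f * k)%N%:Z + m)%Z) (iota 0 N) = (f%:Z %| m)%Z.
Proof.
move=> N0 f0; case: dvdzP => [[u ->]|nd]; last first.
  apply/eqP; rewrite -leqn0 leqNgt -has_count; apply/hasP => -[k _ /dvdzP[c e]].
  by apply: nd; exists (c * N%:Z - k%:Z); move: e; rewrite !PoszM => e; lia.
pose a := `|((- u) %% N%:Z)%Z|%N.
have a0 : ((- u) %% N%:Z)%Z = a%:Z by rewrite gez0_abs // modz_ge0 // eqz_nat -lt0n.
have aN : (a < N)%N by rewrite -ltz_nat -a0 ltz_pmod.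
rewrite (@eq_in_count _ _ (pred1 a)) => [|k]; last first.
  rewrite mem_iota add0n /= => kN.
  have -> : ((f * k)%N%:Z + u * f%:Z) = (k%:Z - - u) * f%:Z by rewrite PoszM; lia.
  rewrite PoszM dvdz_mul2r ?eqz_nat -?lt0n // -eqz_mod_dvd a0.
  by rewrite modz_small ?ltz_nat // eqz_nat.
by rewrite count_uniq_mem ?iota_uniq // mem_iota add0n aN.
Qed.

Lemma span1P (A : zmodType) (g x : A) :
  inIntSpan (in_tuple [:: g]) x <-> exists a, x = g *~ a.
Proof.
split=> [[a ->]|[a ->]]; first by exists (a ord0); rewrite big_ord1.
by exists [ffun=> a]; rewrite big_ord1 ffunE.
Qed.

Lemma span2P (A : zmodType) (g h x : A) :
  inIntSpan (in_tuple [:: g; h]) x <-> exists a b, x = g *~ a + h *~ b.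
Proof.
split=> [[a ->]|[a [b ->]]].
  by exists (a ord0), (a (lift ord0 ord0)); rewrite big_ord_recl big_ord1.
exists [ffun i : 'I_2 => if i == ord0 then a else b].
by rewrite big_ord_recl big_ord1 !ffunE.
Qed.

Section Kernels.
Variables (p q : seq nat) (pi : {additive string_group p -> string_group q}).
Variables (f e r : 'I_(size p) -> nat) (N : nat) (J : 'I_(size p) -> seq 'I_(size q)).
Hypotheses (wp : weight_sequence p) (wq : weight_sequence q).
Hypothesis (st : standard pi f e r N J).

Lemma std_f_gt0 i : (0 < f i)%N.
Proof.
by have := weight_gt0 i wp; rewrite (std_weight st) muln_gt0 => /andP[].
Qed.

Lemma std_image_mulgen i : pi (gen i *+ f i) = can_elt q *+ r i.
Proof.
rewrite raddfMn (std_gen st); have := std_size st i; case: eqP => [-> _|_ sJ].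
  by rewrite mulr1n.
rewrite -sumrMnl big_seq (eq_bigr (fun=> can_elt q)) => [|j ji].
  by rewrite -big_seq big_const_seq count_predT iter_addr addr0 sJ.
by rewrite -(std_point_weight st ji) gen_weight.
Qed.

Lemma std_image_diff i j : r i = r j -> pi (gen i *+ f i - gen j *+ f j) = 0.
Proof. by move=> rij; rewrite raddfB /= !std_image_mulgen rij subrr. Qed.

Lemma nf_pair (i j : 'I_(size p)) (a b : nat) :
  i != j -> (a < weight p i)%N -> (b < weight p j)%N ->
  let x := gen i *+ a + gen j *+ b - can_elt p in
  [/\ nf_coef x i = a, nf_coef x j = b,
      forall l, l != i -> l != j -> nf_coef x l = 0 & euler x = 0].
Proof.
move=> ij aw bw x; have ji : (j == i) = false by rewrite eq_sym (negPf ij).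
pose l k : int := if k == i then a%:Z else if k == j then b%:Z else 0.
have [k|| c1 c2] := @normal_form_uniq p x l (- 1) wp.
- rewrite /l; case: (eqVneq k i) => [->|_]; first by rewrite ltz_nat.
  case: (eqVneq k j) => [->|_]; first by rewrite ltz_nat.
  by rewrite lexx ltz_nat weight_gt0.
- rewrite mulrN1z /x; congr (_ + _); rewrite (bigD1 i) //= (bigD1 j) ?ji //= /l.
  rewrite eqxx ji eqxx big1 ?addr0 -?pmulrn // => k /andP[/negPf-> /negPf->].
  by rewrite mulr0z.
rewrite /euler c2 addNr; split=> //.
- by rewrite c1 /l eqxx.
- by rewrite c1 /l ji eqxx.
- by move=> k /negPf ki /negPf kj; rewrite c1 /l ki kj.
Qed.

(** The elements k (f_i x_i - f_j x_j) with 0 < k < N have the normal form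
    k f_i x_i + (N - k) f_j x_j - c, hence Euler characteristic 0; their
    coefficients at i and j run through the multiples of f_i and f_j once. *)
Lemma cyclic_kernel i j : cyclic_ramification e N i j ->
  admissible pi /\ kernel_generated_by pi [:: gen i *+ f i - gen j *+ f j].
Proof.
move=> [ij eE]; have N0 := std_order_gt0 st.
have ei : e i = N by rewrite eE !inE eqxx.
have ej : e j = N by rewrite eE !inE eqxx orbT.
have ri : r i = 1%N by have := std_order st i; rewrite ei; nia.
have rj : r j = 1%N by have := std_order st j; rewrite ej; nia.
have wi : weight p i = (N * f i)%N by rewrite (std_weight st) ei.
have wj : weight p j = (N * f j)%N by rewrite (std_weight st) ej.
set g := gen i *+ f i - gen j *+ f j.
have pg : pi g = 0 by apply: std_image_diff; rewrite ri rj.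
have gk k : (0 < k < N)%N ->
    g *+ k = gen i *+ (f i * k) + gen j *+ (f j * (N - k)) - can_elt p.
  move=> /andP[k0 kN]; rewrite /g mulrnBl -!mulrnA mulnBr mulrnBr; last first.
    by rewrite leq_mul2l ltnW ?orbT.
  by rewrite [(f j * N)%N]mulnC -wj gen_weight addrA [RHS]addrAC addrK.
have fi0 := std_f_gt0 i; have fj0 := std_f_gt0 j.
have nfg k : (0 < k < N)%N -> [/\ nf_coef (g *+ k) i = (f i * k)%N,
    nf_coef (g *+ k) j = (f j * (N - k))%N,
    forall l, l != i -> l != j -> nf_coef (g *+ k) l = 0 & euler (g *+ k) = 0].
  by move=> kN; rewrite gk //; apply: nf_pair => //; rewrite ?wi ?wj; nia.
have c0 l : nf_coef (g *+ 0) l = 0 by rewrite mulr0n; have [->] := nf0 wp.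
have gi k : (k < N)%N -> nf_coef (g *+ k) i = (f i * k)%N.
  by case: k => [|k] kN; [rewrite muln0 c0 | have [] := nfg k.+1 kN].
have go k l : (k < N)%N -> l != i -> l != j -> nf_coef (g *+ k) l = 0.
  by case: k => [|k] kN; [rewrite c0 | have [_ _ + _] := nfg k.+1 kN; apply].
pose hs := [seq g *+ k | k <- iota 0 N].
have hsP h : reflect (exists2 k, (k < N)%N & h = g *+ k) (h \in hs).
  by apply: (iffP mapP) => -[k]; rewrite ?mem_iota => kN ->; exists k; rewrite ?mem_iota.
have [||||||hsK adm] := @recognition p q pi f e r N J wp wq st hs.
- by rewrite (leq_trans _ (ltn_ord i)).
- rewrite map_inj_in_uniq ?iota_uniq // => k k'; rewrite !mem_iota !add0n /= => kN k'N.
  move/(congr1 (fun x => nf_coef x i)); rewrite !gi // => -[/eqP].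
  by rewrite eqn_pmul2l // => /eqP.
- by apply/hsP; exists 0%N; rewrite ?mulr0n.
- move=> _ /hsP[[|k] kN ->]; first by rewrite mulr0n eqxx.
  by move=> _; have [] := nfg k.+1 kN.
- move=> l m; rewrite /ram count_map.
  have [->|li] := eqVneq l i.
    rewrite ri -[RHS]/(nat_of_bool (_ %| _)%Z) -(count_multiples m N0 fi0) wi.
    by apply: eq_in_count => k; rewrite mem_iota add0n /= => kN; rewrite gi.
  have [->|lj] := eqVneq l j.
    have E k : (k < N)%N -> ((weight p j)%:Z %| nf_coef (g *+ k) j + m)%Z =
        ((weight p j)%:Z %| (f j * k)%N%:Z - m)%Z.
      case: k => [|k] kN; first by rewrite c0 add0r muln0 sub0r rpredN.
      have [_ -> _ _] := nfg k.+1 kN; rewrite -rpredN.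
      rewrite -[LHS](rpredDr _ (dvdzz (weight p j)%:Z)); congr (_ %| _)%Z.
      by rewrite wj; nia.
    rewrite rj -rpredN -[RHS]/(nat_of_bool (_ %| _)%Z) -(count_multiples _ N0 fj0) -wj.
    by apply: eq_in_count => k; rewrite mem_iota add0n /= => /E.
  have el : e l = 1%N by rewrite eE !inE (negPf li) (negPf lj).
  have rl : r l = N by have := std_order st l; rewrite el muln1.
  rewrite (std_weight st) el mul1n rl.
  rewrite (@eq_in_count _ _ (fun=> ((f l)%:Z %| m)%Z)) => [|k]; last first.
    by rewrite mem_iota add0n /= => kN; rewrite go // add0r.
  by case: (_ %| _)%Z; rewrite ?count_predT ?count_pred0 ?size_iota.
- by move=> _ /hsP[k _ ->]; rewrite raddfMn pg mul0rn.
split=> // x; split=> [px|/span1P[a ->]]; last by rewrite raddfMz /= pg mul0rz.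
apply/span1P; have /hsP[k _ ->] : x \in hs by rewrite (kernel_enumP hsK) px.
by exists k%:Z.
Qed.

(** Here c = 2 f_i x_i at each of the three indices, so the three nonzero elements
    have the normal forms f_i x_i + f_j x_j - c. *)
Lemma klein_kernel i j k : klein_ramification e N i j k ->
  admissible pi /\
  kernel_generated_by pi
    [:: gen i *+ f i - gen j *+ f j; gen i *+ f i - gen k *+ f k].
Proof.
move=> [N4 + eE]; rewrite /= !inE negb_or andbT => /andP[/andP[ij ik] jk].
have rE l : l \in [:: i; j; k] -> r l = 2%N.
  by move=> lin; have := std_order st l; rewrite eE lin N4; lia.
have [ri rj rk] : [/\ r i = 2, r j = 2 & r k = 2]%N.
  by split; apply: rE; rewrite !inE eqxx ?orbT.
have wE l : l \in [:: i; j; k] -> weight p l = (2 * f l)%N.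
  by move=> lin; rewrite (std_weight st) eE lin.
have [wi wj wk] : [/\ weight p i = 2 * f i, weight p j = 2 * f j & weight p k = 2 * f k]%N.
  by split; apply: wE; rewrite !inE eqxx ?orbT.
have diffE (a b : 'I_(size p)) : weight p b = (2 * f b)%N ->
    gen a *+ f a - gen b *+ f b = gen a *+ f a + gen b *+ f b - can_elt p.
  by move=> wb; rewrite -(gen_weight b) wb mul2n -addnn mulrnDr opprD addrA addrK.
have [fi0 fj0 fk0] := And3 (std_f_gt0 i) (std_f_gt0 j) (std_f_gt0 k).
set g := gen i *+ f i - gen j *+ f j; set h := gen i *+ f i - gen k *+ f k.
have gh : g + h = gen j *+ f j + gen k *+ f k - can_elt p.
  have double (a : 'I_(size p)) : weight p a = (2 * f a)%N ->
      gen a *+ f a + gen a *+ f a = can_elt p.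
    by move=> wa; rewrite -mulrnDr addnn -mul2n -wa gen_weight.
  by rewrite -diffE // /g /h addrACA double // -(double j wj) addrACA subrr add0r.
have [gi gj go ge] : [/\ nf_coef g i = f i, nf_coef g j = f j,
    forall l, l != i -> l != j -> nf_coef g l = 0 & euler g = 0].
  by rewrite /g diffE //; apply: nf_pair => //; rewrite ?wi ?wj; lia.
have [hi hk ho he] : [/\ nf_coef h i = f i, nf_coef h k = f k,
    forall l, l != i -> l != k -> nf_coef h l = 0 & euler h = 0].
  by rewrite /h diffE //; apply: nf_pair => //; rewrite ?wi ?wk; lia.
have [sj sk so se] : [/\ nf_coef (g + h) j = f j, nf_coef (g + h) k = f k,
    forall l, l != j -> l != k -> nf_coef (g + h) l = 0 & euler (g + h) = 0].
  by rewrite gh; apply: nf_pair => //; rewrite ?wj ?wk; lia.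
have z l : nf_coef (0 : string_group p) l = 0 by have [->] := nf0 wp.
have [ji ki kj] : [/\ j != i, k != i & k != j] by rewrite eq_sym ij eq_sym ik eq_sym jk.
have pg : pi g = 0 by apply: std_image_diff; rewrite ri rj.
have ph : pi h = 0 by apply: std_image_diff; rewrite ri rk.
pose hs := [:: 0; g; h; g + h].
have two l m : (0 < f l)%N ->
    (((2 * f l)%N%:Z %| m)%Z + ((2 * f l)%N%:Z %| ((f l)%:Z + m)%R)%Z = ((f l)%:Z %| m)%Z)%N.
  move=> f0; have := @count_multiples 2 (f l) m isT f0.
  by rewrite /= muln0 muln1 add0r addn0.
have [||||||hsK adm] := @recognition p q pi f e r N J wp wq st hs.
- by rewrite (leq_trans _ (ltn_ord i)).
- apply: (@map_uniq _ _ (fun x => (nf_coef x i, nf_coef x j))).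
  rewrite /hs /= !z gi gj hi (ho j) // sj (so i) //.
  by move: fi0 fj0; rewrite !inE !xpair_eqE; clear; lia.
- by rewrite inE eqxx.
- by move=> x; rewrite !inE => /or4P[]/eqP-> //; rewrite eqxx.
- move=> l m; rewrite /ram /=.
  have [->|li] := eqVneq l i.
    by rewrite z gi hi so // wi ri add0r; have := two i m fi0; case: (f i %| m)%Z; lia.
  have [->|lj] := eqVneq l j.
    by rewrite z gj ho // sj wj rj add0r; have := two j m fj0; case: (f j %| m)%Z; lia.
  have [->|lk] := eqVneq l k.
    by rewrite z go // hk sk wk rk add0r; have := two k m fk0; case: (f k %| m)%Z; lia.
  have el : e l = 1%N by rewrite eE !inE (negPf li) (negPf lj) (negPf lk).
  have rl : r l = 4%N by have := std_order st l; rewrite el muln1 N4.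
  by rewrite z go // ho // so // (std_weight st) el mul1n rl add0r; case: (_ %| _)%Z.
- move=> x; rewrite !inE => /or4P[]/eqP-> //; first exact: raddf0.
  by rewrite raddfD [pi g]pg [pi h]ph addr0.
split=> // x; split=> [px|/span2P[a [b ->]]]; last first.
  by rewrite raddfD !raddfMz /= pg ph !mul0rz addr0.
have : x \in hs by rewrite (kernel_enumP hsK) px.
rewrite !inE => /or4P[]/eqP->; apply/span2P.
- by exists 0, 0; rewrite !mulr0z addr0.
- by exists 1, 0; rewrite mulr0z addr0.
- by exists 0, 1; rewrite mulr0z add0r.
- by exists 1, 1.
Qed.

End Kernels.

(** * Homomorphisms with prescribed ramification *)

(** For f i = 1 the sum over the points is replaced by r i times the canonical
    element; in both cases f i times the image of x_i is r i times it. *)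
Lemma standard_exists (p q : seq nat) (f e r : 'I_(size p) -> nat) (N : nat)
    (J : 'I_(size p) -> seq 'I_(size q)) :
  (forall i : 'I_(size p), weight p i = (e i * f i)%N) ->
  (forall i : 'I_(size p), (r i * e i)%N = N) -> (0 < N)%N ->
  perm_eq (flatten [seq J i | i <- enum 'I_(size p)]) (enum 'I_(size q)) ->
  (forall i : 'I_(size p), size (J i) = (if f i == 1 then 0 else r i)%N) ->
  (forall (i : 'I_(size p)) (j : 'I_(size q)), j \in J i -> weight q j = f i) ->
  exists pi : {additive string_group p -> string_group q}, standard pi f e r N J.
Proof.
move=> wE rE N0 pJ sJ wJ.
pose y i := if f i == 1%N then can_elt q *+ r i else \sum_(j <- J i) gen j.
have [|pi [pg pc]] := @string_group_lift p _ y (can_elt q *+ N).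
  move=> i; rewrite wE mulnC mulrnA -(rE i) mulrnA; congr (_ *+ _).
  rewrite /y; have := sJ i; case: eqP => [-> _|_ s]; first by rewrite mulr1n.
  rewrite -sumrMnl big_seq (eq_bigr (fun=> can_elt q)) => [|j ji].
    by rewrite -big_seq big_const_seq count_predT iter_addr addr0 s.
  by rewrite -(wJ _ _ ji) gen_weight.
by exists pi; split.
Qed.

Definition ords (n : nat) (l : seq nat) : seq 'I_n := pmap insub l.

Lemma val_ords (n : nat) (l : seq nat) :
  all (fun k => k < n)%N l -> [seq val i | i <- ords n l] = l.
Proof.
move=> ln; rewrite (pmap_filter (@insubK _ _ _)) -[RHS](all_filterP ln).
by apply: eq_filter => k; rewrite isSome_insub.
Qed.

Lemma nth_gens (p : seq nat) (c : string_group p) (i : 'I_(size p)) :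
  nth c (gens p) i = gen i.
Proof. by rewrite (nth_map i) ?size_enum_ord // nth_ord_enum. Qed.

Lemma nth_gens_default (p : seq nat) (c : string_group p) (k : nat) :
  (size p <= k)%N -> nth c (gens p) k = c.
Proof. by move=> pk; rewrite nth_default // size_map size_enum_ord. Qed.

Lemma map_enum_ord (T : Type) (x0 : T) (s : seq T) (n : nat) :
  size s = n -> [seq nth x0 s (val i) | i <- enum 'I_n] = s.
Proof. by move=> <-; rewrite (map_comp (nth x0 s) val) val_enum_ord map_nth_iota0 ?take_size. Qed.

(** Ramification over one exceptional point: the weight f, the index e, the
    number r of points over it and the positions of these points in q. *)
Record branch := Branch { bf : nat; be : nat; br : nat; bpts : seq nat }.

Definition branch_ok (q : seq nat) (N : nat) (b : branch) : bool :=
  [&& (br b * be b == N)%N, size (bpts b) == (if bf b == 1 then 0 else br b)%N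
    & all (fun j => (j < size q)%N && (nth 1%N q j == bf b)) (bpts b)].

Definition branches_ok (p q : seq nat) (N : nat) (D : seq branch) : bool :=
  [&& p == [seq be b * bf b | b <- D]%N, all (branch_ok q N) D
    & perm_eq (flatten [seq bpts b | b <- D]) (iota 0 (size q))].

Definition branch_image (q : seq nat) (b : branch) : string_group q :=
  if bf b == 1%N then can_elt q *+ br b
  else \sum_(j <- bpts b) nth (can_elt q) (gens q) j.

Definition branch0 := Branch 0 0 0 [::].

Definition branch_at (p : seq nat) (D : seq branch) (i : 'I_(size p)) : branch :=
  nth branch0 D i.

Lemma branches_standard (p q : seq nat) (N : nat) (D : seq branch) :
  (0 < N)%N -> branches_ok p q N D ->
  exists pi : {additive string_group p -> string_group q},
    standard pi (fun i => bf (branch_at D i)) (fun i => be (branch_at D i))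
      (fun i => br (branch_at D i)) N (fun i => ords (size q) (bpts (branch_at D i)))
    /\ [seq pi x | x <- gens p] = [seq branch_image q b | b <- D].
Proof.
move=> N0 /and3P[/eqP pE okD permD].
have sD : size D = size p by rewrite pE size_map.
have okP (i : 'I_(size p)) : branch_ok q N (branch_at D i).
  by apply: (all_nthP branch0 okD); rewrite sD.
have ptsP (i : 'I_(size p)) :
    [seq val j | j <- ords (size q) (bpts (branch_at D i))] = bpts (branch_at D i).
  have /and3P[_ _ okJ] := okP i; apply: val_ords.
  by apply: sub_all okJ => j /andP[].
have [||| i | i j |pi st] := @standard_exists p q (fun i => bf (branch_at D i))
    (fun i => be (branch_at D i)) (fun i => br (branch_at D i)) N
    (fun i => ords (size q) (bpts (branch_at D i))) _ _ N0.
- by move=> i; rewrite /weight {1}pE (nth_map branch0) ?sD.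
- by move=> i; have /and3P[/eqP] := okP i.
- apply: (perm_map_inj val_inj); rewrite val_enum_ord map_flatten -map_comp.
  rewrite (eq_map (g := fun i => bpts (branch_at D i))) => [|i]; last exact: ptsP.
  by rewrite (map_comp bpts) map_enum_ord.
- by have /and3P[_ /eqP <- _] := okP i; rewrite -[in RHS](ptsP i) size_map.
- move=> ji; have /and3P[_ _ /allP okJ] := okP i.
  have /okJ/andP[_ /eqP] // : val j \in bpts (branch_at D i).
  by rewrite -(ptsP i) map_f.
exists pi; split=> //.
rewrite -[in RHS](map_enum_ord branch0 sD) -!map_comp; apply: eq_map => i /=.
rewrite (std_gen st) /branch_image -/(branch_at D i); case: eqP => // _.
rewrite -[in RHS](ptsP i) big_map; apply: eq_bigr => j _.
by rewrite nth_gens.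
Qed.

Definition realises (p q : seq nat) (y : seq (string_group q)) (K : seq (string_group p))
    : Prop :=
  exists pi : {additive string_group p -> string_group q},
    [/\ map pi (gens p) = y,
        forall pi' : {additive string_group p -> string_group q},
          map pi' (gens p) = y -> pi' =1 pi,
        admissible pi
      & kernel_generated_by pi K].

Lemma gens_determine (p q : seq nat)
    (pi pi' : {additive string_group p -> string_group q}) :
  (0 < size p)%N -> map pi' (gens p) = map pi (gens p) -> pi' =1 pi.
Proof.
move=> p0 e; apply: additive_eq_gen => // i; have := congr1 (nth 0 ^~ i) e.
by rewrite !(nth_map 0) ?size_map -?enumT ?size_enum_ord // nth_gens.
Qed.

Lemma cyclic_branches (p q : seq nat) (N : nat) (D : seq branch) (i j : nat)
    (y : seq (string_group q)) :
  weight_sequence p -> weight_sequence q -> (0 < N)%N -> branches_ok p q N D ->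
  (i < size p)%N -> (j < size p)%N -> i != j ->
  [seq be b | b <- D] = [seq (if k \in [:: i; j] then N else 1)%N | k <- iota 0 (size p)] ->
  [seq branch_image q b | b <- D] = y ->
  let c := can_elt p in let xs := gens p in
  realises y
    [:: nth c xs i *+ bf (nth branch0 D i) - nth c xs j *+ bf (nth branch0 D j)].
Proof.
move=> wp wq N0 ok ip jp ij eD <- c xs.
have [pi [st piy]] := branches_standard N0 ok; exists pi.
have cyc : cyclic_ramification (fun k => be (branch_at D k)) N (Ordinal ip) (Ordinal jp).
  split=> // k; have sD : size D = size p by have /and3P[/eqP->] := ok; rewrite size_map.
  by rewrite -(nth_map branch0 0%N be) ?sD // eD (nth_map 0%N) ?size_iota // nth_iota.
have [adm ker] := cyclic_kernel wp wq st cyc.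
split=> //; last by rewrite -[i]/(val (Ordinal ip)) -[j]/(val (Ordinal jp)) !nth_gens.
by move=> pi'; rewrite -piy; apply/gens_determine/(leq_ltn_trans (leq0n i) ip).
Qed.

Lemma klein_branches (p q : seq nat) (D : seq branch) (y : seq (string_group q)) :
  weight_sequence p -> weight_sequence q -> branches_ok p q 4 D ->
  (2 < size p)%N ->
  [seq be b | b <- D] = [seq (if k \in [:: 0; 1; 2] then 2 else 1)%N | k <- iota 0 (size p)] ->
  [seq branch_image q b | b <- D] = y ->
  let c := can_elt p in let xs := gens p in
  realises y
    [:: nth c xs 0 *+ bf (nth branch0 D 0) - nth c xs 1 *+ bf (nth branch0 D 1);
        nth c xs 0 *+ bf (nth branch0 D 0) - nth c xs 2 *+ bf (nth branch0 D 2)].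
Proof.
move=> wp wq ok p2 eD <- c xs.
have [pi [st piy]] := @branches_standard p q 4 D isT ok; exists pi.
have [p1 p0] : (1 < size p)%N /\ (0 < size p)%N by split; apply: ltn_trans p2.
have kl : klein_ramification (fun k => be (branch_at D k)) 4
    (Ordinal p0) (Ordinal p1) (Ordinal p2).
  split=> // k; have sD : size D = size p by have /and3P[/eqP->] := ok; rewrite size_map.
  by rewrite -(nth_map branch0 0%N be) ?sD // eD (nth_map 0%N) ?size_iota // nth_iota.
have [adm ker] := klein_kernel wp wq st kl.
split=> //; last first.
  by rewrite -[0%N]/(val (Ordinal p0)) -[1%N]/(val (Ordinal p1))
    -[2%N]/(val (Ordinal p2)) !nth_gens.
by move=> pi'; rewrite -piy; apply: gens_determine.
Qed.

(* The conditions on the branches hold by computation, up to reflexive comparisons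
   of the parameters; the last alternative compares the images. *)
Ltac row_check :=
  first [ done
        | by rewrite /branches_ok /= /branch_ok /= ?mul1n ?muln1 ?eqxx
        | by rewrite /= /branch_image /= ?big_cons ?big_nil ?addr0 ?addrA ].

Lemma row_realised (T : weight_type) (p q : seq nat)
    (K : seq (string_group p)) (y : seq (string_group q)) :
  row_on (gens p) (can_elt p) (gens q) (can_elt q) T p q K y -> realises y K.
Proof.
(* The generators depend on p and q, which therefore have to be separated from
   the indices of the row before a case analysis. *)
have main P Q : row_on (gens p) (can_elt p) (gens q) (can_elt q) T P Q K y ->
    p = P -> q = Q -> realises y K; last by move=> /main; apply.
rewrite /row_on; case.
- move=> ep eq; subst p q; apply: (@cyclic_branches _ _ 2
    [:: Branch 1 2 1 [::]; Branch 3 1 2 [:: 1; 2]; Branch 2 2 1 [:: 0]]%N 0 2 _); row_check.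
- move=> ep eq; subst p q; apply: (@cyclic_branches _ _ 3
    [:: Branch 2 1 3 [:: 0; 1; 2]; Branch 1 3 1 [::]; Branch 1 3 1 [::]]%N 1 2 _); row_check.
- move=> [//|[|a]] _ ep; rewrite /drop_ones /= => eq; subst p q.
    (* The point over the last entry has weight 1. *)
    rewrite (nth_gens_default _ (k := 2)) //.
    apply: (@cyclic_branches _ _ 2
      [:: Branch 2 1 2 [:: 0; 1]; Branch 1 2 1 [::]; Branch 1 2 1 [::]]%N 1 2 _); row_check.
  apply: (@cyclic_branches _ _ 2
    [:: Branch 2 1 2 [:: 0; 1]; Branch 1 2 1 [::]; Branch a.+2 2 1 [:: 2]]%N 1 2 _); row_check.
- move=> [//|[|a]] _ ep; rewrite /drop_ones /= => eq; subst p q.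
    rewrite !(@nth_gens_default [::]) // -mulr2n.
    apply: (@klein_branches _ _
      [:: Branch 1 2 2 [::]; Branch 1 2 2 [::]; Branch 1 2 2 [::]]%N _); row_check.
  apply: (@klein_branches _ _
    [:: Branch 1 2 2 [::]; Branch 1 2 2 [::]; Branch a.+2 2 2 [:: 0; 1]]%N _); row_check.
- move=> [|[|a]] // _ ep eq; subst p q.
  apply: (@cyclic_branches _ _ 2
    [:: Branch 1 2 1 [::]; Branch 1 2 1 [::]; Branch a.+2 1 2 [:: 0; 1]]%N 0 1 _); row_check.
- move=> [|[|n]] [|[|a]] [|[|b]] // _ _ _ ep eq; subst p q.
  apply: (@cyclic_branches _ _ n.+2
    [:: Branch a.+2 n.+2 1 [:: 0]; Branch b.+2 n.+2 1 [:: 1]]%N 0 1 _); row_check.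
- move=> [|[|n]] [|[|a]] // _ _ ep eq; subst p q.
  apply: (@cyclic_branches _ _ n.+2
    [:: Branch a.+2 n.+2 1 [:: 0]; Branch 1 n.+2 1 [::]]%N 0 1 _); row_check.
- move=> [|[|n]] // _ ep eq; subst p q.
  apply: (@cyclic_branches _ _ n.+2
    [:: Branch 1 n.+2 1 [::]; Branch 1 n.+2 1 [::]]%N 0 1 _); row_check.
- move=> ep eq; subst p q; apply: (@cyclic_branches _ _ 2
    [:: Branch 1 2 1 [::]; Branch 1 2 1 [::]; Branch 2 1 2 [:: 0; 1]; Branch 2 1 2 [:: 2; 3]]%N 0 1 _); row_check.
- move=> ep eq; subst p q; apply: (@klein_branches _ _
    [:: Branch 1 2 2 [::]; Branch 1 2 2 [::]; Branch 1 2 2 [::]; Branch 2 1 4 [:: 0; 1; 2; 3]]%N _); row_check.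
- move=> ep eq; subst p q; apply: (@cyclic_branches _ _ 2
    [:: Branch 2 2 1 [:: 2]; Branch 4 1 2 [:: 0; 1]; Branch 1 2 1 [::]]%N 0 2 _); row_check.
- move=> ep eq; subst p q; apply: (@cyclic_branches _ _ 4
    [:: Branch 1 4 1 [::]; Branch 1 4 1 [::]; Branch 2 1 4 [:: 0; 1; 2; 3]]%N 0 1 _); row_check.
- move=> ep eq; subst p q; apply: (@cyclic_branches _ _ 2
    [:: Branch 2 2 1 [:: 0]; Branch 2 2 1 [:: 1]; Branch 2 1 2 [:: 2; 3]]%N 0 1 _); row_check.
- move=> ep eq; subst p q; apply: (@klein_branches _ _
    [:: Branch 2 2 2 [:: 0; 1]; Branch 2 2 2 [:: 2; 3]; Branch 1 2 2 [::]]%N _); row_check.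
- move=> ep eq; subst p q; apply: (@cyclic_branches _ _ 3
    [:: Branch 1 3 1 [::]; Branch 1 3 1 [::]; Branch 3 1 3 [:: 0; 1; 2]]%N 0 1 _); row_check.
- move=> ep eq; subst p q; apply: (@cyclic_branches _ _ 2
    [:: Branch 3 2 1 [:: 0]; Branch 3 1 2 [:: 1; 2]; Branch 1 2 1 [::]]%N 0 2 _); row_check.
- move=> ep eq; subst p q; apply: (@cyclic_branches _ _ 3
    [:: Branch 2 3 1 [:: 0]; Branch 1 3 1 [::]; Branch 2 1 3 [:: 1; 2; 3]]%N 0 1 _); row_check.
Qed.

(** * Reading off the row *)

Lemma weighted_gensE (p : seq nat) :
  weighted_gens p = [seq (weight p i, gen i) | i : 'I_(size p) <- enum 'I_(size p)].
Proof. by rewrite -zip_map (map_enum_ord 1%N (erefl (size p))). Qed.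

Lemma enum_by_weights (p P : seq nat) : perm_eq p P ->
  exists2 s, perm_eq s (enum 'I_(size p)) & [seq weight p i | i : 'I_(size p) <- s] = P.
Proof.
rewrite perm_sym => /(perm_iotaP 1%N)[Is pIs ->].
have vs : [seq val i | i <- ords (size p) Is] = Is.
  by apply: val_ords; apply/allP => k; rewrite (perm_mem pIs) mem_iota.
exists (ords (size p) Is); first by apply: (perm_map_inj val_inj); rewrite vs val_enum_ord.
by rewrite -[in RHS]vs -map_comp.
Qed.

Definition has_row (T : weight_type) (p q : seq nat)
    (pi : {additive string_group p -> string_group q}) : Prop :=
  exists (xs : seq (nat * string_group p)) (zs : seq (nat * string_group q))
         (K : seq (string_group p)),
    [/\ perm_eq xs (weighted_gens p), perm_eq zs (weighted_gens q),
        row_on (unzip2 xs) (can_elt p) (unzip2 zs) (can_elt q)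
          T (unzip1 xs) (unzip1 zs) K (map pi (unzip2 xs))
      & kernel_generated_by pi K].

(* Both sides are explicit, so that counting leaves linear arithmetic. *)
Ltac perm_list := by apply/permP => x; rewrite /= ?cats0 /=; lia.

Lemma cyclic_sym (I : eqType) (e : I -> nat) (N : nat) (i j : I) :
  cyclic_ramification e N i j -> cyclic_ramification e N j i.
Proof.
move=> [ij eE]; split=> [|k]; first by rewrite eq_sym.
by rewrite eE !inE orbC.
Qed.

(** The order of the entries is chosen to have the ramified ones first. *)
Definition cyclic3 (p : seq nat) (e : 'I_(size p) -> nat) (N : nat)
    (i j k : 'I_(size p)) : Prop :=
  perm_eq [:: i; j; k] (enum 'I_(size p)) /\ cyclic_ramification e N i j.

Lemma complete_enum (n : nat) (l : seq 'I_n) : uniq l ->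
  exists s, perm_eq (l ++ s) (enum 'I_n).
Proof.
move=> ul; exists [seq x <- enum 'I_n | x \notin l].
apply: perm_trans (permEl (perm_filterC (mem l) (enum 'I_n))).
apply: perm_cat => //; apply: uniq_perm => // [|x]; first exact/filter_uniq/enum_uniq.
by rewrite mem_filter mem_enum andbT.
Qed.

Lemma cyclic3_cases (p : seq nat) (e : 'I_(size p) -> nat) (N : nat) i j a b c :
  perm_eq [:: a; b; c] (enum 'I_(size p)) -> cyclic_ramification e N i j ->
  [\/ cyclic3 e N a b c, cyclic3 e N a c b | cyclic3 e N b c a].
Proof.
move=> pm cyc.
have pac : perm_eq [:: a; c; b] (enum 'I_(size p)) by apply: perm_trans pm; perm_list.
have pbc : perm_eq [:: b; c; a] (enum 'I_(size p)) by apply: perm_trans pm; perm_list.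
have inl l : l \in [:: a; b; c] by rewrite (perm_mem pm) mem_enum.
have sym := cyclic_sym cyc; have ij := cyc.1.
move: (inl i) (inl j) ij; rewrite !inE => /or3P[]/eqP ei /or3P[]/eqP ej;
  rewrite ei ej ?eqxx // in cyc sym *.
- by constructor 1.
- by constructor 2.
- by constructor 1.
- by constructor 3.
- by constructor 2.
- by constructor 3.
Qed.

Lemma klein_reorder (p : seq nat) (e : 'I_(size p) -> nat) (N : nat) i j k a b c :
  perm_eq [:: a; b; c] (enum 'I_(size p)) -> klein_ramification e N i j k ->
  klein_ramification e N a b c.
Proof.
move=> pm [NE u eE].
have pijk : perm_eq [:: i; j; k] [:: a; b; c].
  have [s ps] := complete_enum u; have := perm_size (perm_trans pm _).
  rewrite perm_sym in ps; move=> /(_ _ ps) /=; case: s ps => // ps _.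
  by rewrite perm_sym; apply: perm_trans pm ps.
split=> //; first by rewrite -(perm_uniq pijk).
by move=> l; rewrite eE (perm_mem pijk).
Qed.

Section Matching.
Variables (p q : seq nat).
Variable pi : {additive string_group p -> string_group q}.
Variables (f e r : 'I_(size p) -> nat) (N : nat) (J : 'I_(size p) -> seq 'I_(size q)).
Hypotheses (wp : weight_sequence p) (wq : weight_sequence q).
Hypothesis (st : standard pi f e r N J).
Hypothesis (N1 : (1 < N)%N).

Lemma has_row_ordered (T : weight_type) (s : seq 'I_(size p)) (t : seq 'I_(size q)) K :
  perm_eq s (enum 'I_(size p)) -> perm_eq t (flatten [seq J i | i <- s]) ->
  kernel_generated_by pi K ->
  row_on (map gen s) (can_elt p) (map gen t) (can_elt q)
    T [seq weight p i | i : 'I_(size p) <- s] [seq weight q j | j : 'I_(size q) <- t] K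
    [seq pi (gen i) | i <- s] ->
  has_row T pi.
Proof.
move=> ps pt kerK rowK; exists [seq (weight p i, gen i) | i : 'I_(size p) <- s].
exists [seq (weight q j, gen j) | j : 'I_(size q) <- t], K.
rewrite /unzip1 /unzip2 -!map_comp; split=> //; rewrite weighted_gensE.
- exact: perm_map.
- apply/perm_map/(perm_trans pt); apply: perm_trans (std_partition st).
  by apply: perm_flatten; apply: perm_map.
Qed.

Lemma no_point i : f i = 1%N -> J i = [::] /\ pi (gen i) = can_elt q *+ r i.
Proof.
move=> fi; have := std_size st i; rewrite (std_gen st) fi eqxx; split=> //.
exact: size0nil.
Qed.

Lemma points i : f i != 1%N ->
  [/\ size (J i) = r i, forall j, j \in J i -> weight q j = f i
    & pi (gen i) = \sum_(j <- J i) gen j].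
Proof.
move=> fi; have sJ := std_size st i; rewrite (negPf fi) in sJ; split=> //.
  by move=> j; apply: (std_point_weight st).
by rewrite (std_gen st) (negPf fi).
Qed.

Lemma one_point i : f i != 1%N -> r i = 1%N -> exists z,
  [/\ J i = [:: z], weight q z = f i & pi (gen i) = gen z].
Proof.
move=> /points + ri; rewrite ri; case E: (J i) => [|z [|]] [] // _ w ->.
by exists z; rewrite big_seq1 w ?inE.
Qed.

Lemma two_points i : f i != 1%N -> r i = 2%N -> exists z1 z2,
  [/\ J i = [:: z1; z2], (weight q z1 = f i) /\ (weight q z2 = f i)
    & pi (gen i) = gen z1 + gen z2].
Proof.
move=> /points + ri; rewrite ri; case E: (J i) => [|z1 [|z2 [|]]] [] // _ w ->.
by exists z1, z2; rewrite !big_cons big_nil addr0 !w ?inE ?eqxx ?orbT.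
Qed.

Lemma three_points i : f i != 1%N -> r i = 3%N -> exists z1 z2 z3,
  [/\ J i = [:: z1; z2; z3],
      [/\ weight q z1 = f i, weight q z2 = f i & weight q z3 = f i]
    & pi (gen i) = gen z1 + gen z2 + gen z3].
Proof.
move=> /points + ri; rewrite ri; case E: (J i) => [|z1 [|z2 [|z3 [|]]]] [] // _ w ->.
by exists z1, z2, z3; rewrite !big_cons big_nil addr0 addrA !w ?inE ?eqxx ?orbT.
Qed.

Lemma four_points i : f i != 1%N -> r i = 4%N -> exists z1 z2 z3 z4,
  [/\ J i = [:: z1; z2; z3; z4],
      [/\ weight q z1 = f i, weight q z2 = f i, weight q z3 = f i & weight q z4 = f i]
    & pi (gen i) = gen z1 + gen z2 + gen z3 + gen z4].
Proof.
move=> /points + ri; rewrite ri; case E: (J i) => [|z1 [|z2 [|z3 [|z4 [|]]]]] [] // _ w ->.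
by exists z1, z2, z3, z4; rewrite !big_cons big_nil addr0 !addrA !w ?inE ?eqxx ?orbT.
Qed.

Lemma cyclic_ramified i j : cyclic_ramification e N i j ->
  [/\ weight p i = N * f i, weight p j = N * f j, r i = 1 & r j = 1]%N.
Proof.
move=> [_ eE]; have re k : e k = N -> r k = 1%N.
  by move=> ek; have := std_order st k; rewrite ek; nia.
have ei : e i = N by rewrite eE inE eqxx.
have ej : e j = N by rewrite eE !inE eqxx orbT.
by rewrite !(std_weight st) ei ej !re.
Qed.

Lemma cyclic_unramified i j k : cyclic_ramification e N i j -> uniq [:: i; j; k] ->
  f k = weight p k /\ r k = N.
Proof.
move=> [_ eE]; rewrite /= !inE negb_or andbT => /andP[/andP[_ ik] jk].
have ek : e k = 1%N by rewrite eE !inE eq_sym (negPf ik) eq_sym (negPf jk).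
by rewrite (std_weight st) ek mul1n; have := std_order st k; rewrite ek muln1.
Qed.

Lemma klein_ramified i j k : klein_ramification e N i j k ->
  [/\ weight p i = 2 * f i, weight p j = 2 * f j & weight p k = 2 * f k]%N /\
  [/\ r i = 2, r j = 2 & r k = 2]%N.
Proof.
move=> [NE _ eE]; have H l : l \in [:: i; j; k] -> weight p l = (2 * f l)%N /\ r l = 2%N.
  move=> lin; have el : e l = 2%N by rewrite eE lin.
  by rewrite (std_weight st) el; split=> //; have := std_order st l; rewrite el NE; lia.
have [|wi ri] := H i; first by rewrite inE eqxx.
have [|wj rj] := H j; first by rewrite !inE eqxx orbT.
by have [|wk rk] := H k; first by rewrite !inE eqxx !orbT.
Qed.

Lemma mul_prime m a : prime m -> m = (N * a)%N -> N = m /\ a = 1%N.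
Proof.
move=> pm mE; have /primeP[_ /(_ N)] := pm; rewrite {1}mE dvdn_mulr // => /(_ isT).
case/orP=> /eqP NE; first by move: N1; rewrite NE.
split=> //; apply/eqP; rewrite -(eqn_pmul2l (prime_gt0 pm)) muln1.
by rewrite -{1}NE -mE.
Qed.

Lemma cyclic3P i j k : cyclic3 e N i j k ->
  [/\ weight p i = N * f i, weight p j = N * f j & weight p k = f k]%N /\
  [/\ r i = 1, r j = 1 & r k = N]%N.
Proof.
move=> [pm cyc]; have [-> -> -> ->] := cyclic_ramified cyc.
by have [|-> ->] := @cyclic_unramified i j k cyc; first by rewrite (perm_uniq pm) enum_uniq.
Qed.

(** A ramified weight that is prime is equal to N (mul_prime), and N determines f
    and r, hence q and the images. The lists s and t arrange the entries of p and
    q as in the row. *)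
Lemma row_D1 i j k : cyclic3 e N i j k ->
  weight p i = 2%N -> weight p j = 4%N -> weight p k = 3%N -> has_row Domestic pi.
Proof.
move=> c3 wi wj wk; have [[ei ej ek] [ri rj rk]] := cyclic3P c3.
have [NE fi] := @mul_prime 2 _ isT (etrans (esym wi) ei).
have [fj fk] : f j = 2%N /\ f k = 3%N by move: ej ek; rewrite wj wk NE; lia.
have [_ ker] := cyclic_kernel wp wq st c3.2; rewrite fi fj in ker.
have [Ji gi] := no_point fi; rewrite ri in gi.
have [|z [Jj wz gj]] := one_point _ rj; first by rewrite fj.
have [||z1 [z2 [Jk [wz1 wz2] gk]]] := @two_points k; rewrite ?fk ?rk //.
apply: (has_row_ordered (s := [:: i; k; j]) (t := [:: z; z1; z2]) _ _ ker) => /=.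
- by apply: perm_trans c3.1; perm_list.
- by rewrite Ji Jj Jk; perm_list.
rewrite /row_on /= wi wj wk wz wz1 wz2 gi gj gk fj fk.
exact: RowD1.
Qed.

Lemma row_D2 i j k : cyclic3 e N i j k ->
  weight p i = 3%N -> weight p j = 3%N -> weight p k = 2%N -> has_row Domestic pi.
Proof.
move=> c3 wi wj wk; have [[ei ej ek] [ri rj rk]] := cyclic3P c3.
have [NE fi] := @mul_prime 3 _ isT (etrans (esym wi) ei).
have [fj fk] : f j = 1%N /\ f k = 2%N by move: ej ek; rewrite wj wk NE; lia.
have [_ ker] := cyclic_kernel wp wq st c3.2; rewrite fi fj in ker.
have [Ji gi] := no_point fi; rewrite ri in gi.
have [Jj gj] := no_point fj; rewrite rj in gj.
have [||z1 [z2 [z3 [Jk [w1 w2 w3] gk]]]] := @three_points k; rewrite ?fk ?rk //.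
apply: (has_row_ordered (s := [:: k; i; j]) (t := [:: z1; z2; z3]) _ _ ker) => /=.
- by apply: perm_trans c3.1; perm_list.
- by rewrite Ji Jj Jk; perm_list.
rewrite /row_on /= wi wj wk w1 w2 w3 gi gj gk fk.
exact: RowD2.
Qed.

Lemma row_D3 i j k : cyclic3 e N i j k ->
  weight p i = 2%N -> weight p k = 2%N -> has_row Domestic pi.
Proof.
move=> c3 wi wk; have [[ei ej ek] [ri rj rk]] := cyclic3P c3.
have [NE fi] := @mul_prime 2 _ isT (etrans (esym wi) ei).
have fk : f k = 2%N by rewrite -ek.
have [_ ker] := cyclic_kernel wp wq st c3.2; rewrite fi in ker.
have [Ji gi] := no_point fi; rewrite ri in gi.
have [||z1 [z2 [Jk [w1 w2] gk]]] := @two_points k; rewrite ?fk ?rk //.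
have pk : perm_eq [:: k; i; j] (enum 'I_(size p)) by apply: perm_trans c3.1; perm_list.
rewrite NE in ej; have [fj|fj] := eqVneq (f j) 1%N.
  have [Jj gj] := no_point fj; rewrite rj in gj; rewrite fj in ker ej.
  apply: (has_row_ordered (t := [:: z1; z2]) pk _ ker) => /=.
    by rewrite Ji Jj Jk; perm_list.
  rewrite /row_on /= wi wk ej w1 w2 gi gj gk fk.
  exact: (@RowD3 _ _ _ _ _ _ _ _ _ _ _ 1).
have [z [Jj wz gj]] := one_point fj rj.
apply: (has_row_ordered (t := [:: z1; z2; z]) pk _ ker) => /=.
  by rewrite Ji Jj Jk; perm_list.
have f0 := std_f_gt0 wp st j.
rewrite /row_on /= wi wk ej w1 w2 wz gi gj gk fk.
have := @RowD3 _ _ (gen k) (gen i) (gen j) (can_elt p)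
  (gen z1) (gen z2) (gen z) (can_elt q) (can_elt q) (f j) f0.
by rewrite /drop_ones /= fj.
Qed.

Lemma row_D5 i j k : cyclic3 e N i j k ->
  weight p i = 2%N -> weight p j = 2%N -> has_row Domestic pi.
Proof.
move=> c3 wi wj; have [[ei ej ek] [ri rj rk]] := cyclic3P c3.
have [NE fi] := @mul_prime 2 _ isT (etrans (esym wi) ei).
have [_ fj] := @mul_prime 2 _ isT (etrans (esym wj) ej).
have w1 := weight_gt1 k wp.
have [_ ker] := cyclic_kernel wp wq st c3.2; rewrite fi fj in ker.
have [Ji gi] := no_point fi; rewrite ri in gi.
have [Jj gj] := no_point fj; rewrite rj in gj.
have [||z1 [z2 [Jk [wz1 wz2] gk]]] := @two_points k; rewrite -?ek ?rk //.
  by rewrite gtn_eqF.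
apply: (has_row_ordered (t := [:: z1; z2]) c3.1 _ ker) => /=.
  by rewrite Ji Jj Jk; perm_list.
rewrite /row_on /= wi wj wz1 wz2 gi gj gk -ek.
exact: RowD5.
Qed.

Lemma row_T3 i j k : cyclic3 e N i j k ->
  weight p i = 4%N -> weight p j = 2%N -> weight p k = 4%N -> has_row Tubular pi.
Proof.
move=> c3 wi wj wk; have [[ei ej ek] [ri rj rk]] := cyclic3P c3.
have [NE fj] := @mul_prime 2 _ isT (etrans (esym wj) ej).
have [fi fk] : f i = 2%N /\ f k = 4%N by move: ei ek; rewrite wi wk NE; lia.
have [_ ker] := cyclic_kernel wp wq st c3.2; rewrite fi fj in ker.
have [Jj gj] := no_point fj; rewrite rj in gj.
have [|z [Ji wz gi]] := one_point _ ri; first by rewrite fi.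
have [||z1 [z2 [Jk [w1 w2] gk]]] := @two_points k; rewrite ?fk ?rk //.
apply: (has_row_ordered (s := [:: i; k; j]) (t := [:: z1; z2; z]) _ _ ker) => /=.
- by apply: perm_trans c3.1; perm_list.
- by rewrite Ji Jj Jk; perm_list.
rewrite /row_on /= wi wj wk wz w1 w2 gi gj gk fi fk.
exact: RowT3.
Qed.

(** Here N divides 4, and both N = 2 and N = 4 occur. *)
Lemma row_T4_T5 i j k : cyclic3 e N i j k ->
  weight p i = 4%N -> weight p j = 4%N -> weight p k = 2%N -> has_row Tubular pi.
Proof.
move=> c3 wi wj wk; have [[ei ej ek] [ri rj rk]] := cyclic3P c3.
have fk : f k = 2%N by rewrite -ek.
have [_ ker] := cyclic_kernel wp wq st c3.2.
have [[NE fi fj]|[NE fi fj]] : [/\ N = 4, f i = 1 & f j = 1]%N \/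
    [/\ N = 2, f i = 2 & f j = 2]%N.
- move: ei ej N1; rewrite wi wj; case: (f i) => [|[|[|m]]]; last by nia.
  + by rewrite muln0.
  + by rewrite muln1 => <- /eqP; rewrite -[4%N in X in X -> _]muln1 eqn_pmul2l // => /eqP <-; left.
  + by move=> e4 e4' _; right; split; nia.
- rewrite fi fj in ker; have [Ji gi] := no_point fi; rewrite ri in gi.
  have [Jj gj] := no_point fj; rewrite rj in gj.
  have [||z1 [z2 [z3 [z4 [Jk [w1 w2 w3 w4] gk]]]]] := @four_points k; rewrite ?fk ?rk //.
  apply: (has_row_ordered (t := [:: z1; z2; z3; z4]) c3.1 _ ker) => /=.
    by rewrite Ji Jj Jk; perm_list.
  rewrite /row_on /= wi wj wk w1 w2 w3 w4 gi gj gk fk.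
  exact: RowT4.
rewrite fi fj in ker.
have [|z [Ji wz gi]] := one_point _ ri; first by rewrite fi.
have [|z' [Jj wz' gj]] := one_point _ rj; first by rewrite fj.
have [||z1 [z2 [Jk [w1 w2] gk]]] := @two_points k; rewrite ?fk ?rk //.
apply: (has_row_ordered (t := [:: z; z'; z1; z2]) c3.1 _ ker) => /=.
  by rewrite Ji Jj Jk; perm_list.
rewrite /row_on /= wi wj wk wz wz' w1 w2 gi gj gk fi fj fk.
exact: RowT5.
Qed.

Lemma row_T7 i j k : cyclic3 e N i j k ->
  weight p i = 3%N -> weight p j = 3%N -> weight p k = 3%N -> has_row Tubular pi.
Proof.
move=> c3 wi wj wk; have [[ei ej ek] [ri rj rk]] := cyclic3P c3.
have [NE fi] := @mul_prime 3 _ isT (etrans (esym wi) ei).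
have [_ fj] := @mul_prime 3 _ isT (etrans (esym wj) ej).
have fk : f k = 3%N by rewrite -ek.
have [_ ker] := cyclic_kernel wp wq st c3.2; rewrite fi fj in ker.
have [Ji gi] := no_point fi; rewrite ri in gi.
have [Jj gj] := no_point fj; rewrite rj in gj.
have [||z1 [z2 [z3 [Jk [w1 w2 w3] gk]]]] := @three_points k; rewrite ?fk ?rk //.
apply: (has_row_ordered (t := [:: z1; z2; z3]) c3.1 _ ker) => /=.
  by rewrite Ji Jj Jk; perm_list.
rewrite /row_on /= wi wj wk w1 w2 w3 gi gj gk fk.
exact: RowT7.
Qed.

Lemma row_T8 i j k : cyclic3 e N i j k ->
  weight p i = 6%N -> weight p j = 2%N -> weight p k = 3%N -> has_row Tubular pi.
Proof.
move=> c3 wi wj wk; have [[ei ej ek] [ri rj rk]] := cyclic3P c3.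
have [NE fj] := @mul_prime 2 _ isT (etrans (esym wj) ej).
have [fi fk] : f i = 3%N /\ f k = 3%N by move: ei ek; rewrite wi wk NE; lia.
have [_ ker] := cyclic_kernel wp wq st c3.2; rewrite fi fj in ker.
have [Jj gj] := no_point fj; rewrite rj in gj.
have [|z [Ji wz gi]] := one_point _ ri; first by rewrite fi.
have [||z1 [z2 [Jk [w1 w2] gk]]] := @two_points k; rewrite ?fk ?rk //.
apply: (has_row_ordered (s := [:: i; k; j]) (t := [:: z; z1; z2]) _ _ ker) => /=.
- by apply: perm_trans c3.1; perm_list.
- by rewrite Ji Jj Jk; perm_list.
rewrite /row_on /= wi wj wk wz w1 w2 gi gj gk fi fk.
exact: RowT8.
Qed.

Lemma row_T9 i j k : cyclic3 e N i j k ->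
  weight p i = 6%N -> weight p j = 3%N -> weight p k = 2%N -> has_row Tubular pi.
Proof.
move=> c3 wi wj wk; have [[ei ej ek] [ri rj rk]] := cyclic3P c3.
have [NE fj] := @mul_prime 3 _ isT (etrans (esym wj) ej).
have [fi fk] : f i = 2%N /\ f k = 2%N by move: ei ek; rewrite wi wk NE; lia.
have [_ ker] := cyclic_kernel wp wq st c3.2; rewrite fi fj in ker.
have [Jj gj] := no_point fj; rewrite rj in gj.
have [|z [Ji wz gi]] := one_point _ ri; first by rewrite fi.
have [||z1 [z2 [z3 [Jk [w1 w2 w3] gk]]]] := @three_points k; rewrite ?fk ?rk //.
apply: (has_row_ordered (t := [:: z; z1; z2; z3]) c3.1 _ ker) => /=.
  by rewrite Ji Jj Jk; perm_list.
rewrite /row_on /= wi wj wk wz w1 w2 w3 gi gj gk fi fk.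
exact: RowT9.
Qed.

Lemma row_D6_D7_D8 i j : perm_eq [:: i; j] (enum 'I_(size p)) ->
  cyclic_ramification e N i j -> has_row Domestic pi.
Proof.
move=> pm cyc; have [wi wj ri rj] := cyclic_ramified cyc.
have [fi0 fj0] := (std_f_gt0 wp st i, std_f_gt0 wp st j).
have pm' : perm_eq [:: j; i] (enum 'I_(size p)) by apply: perm_trans pm; perm_list.
have [_ ker] := cyclic_kernel wp wq st cyc.
have [_ ker'] := cyclic_kernel wp wq st (cyclic_sym cyc).
have [fi|fi] := eqVneq (f i) 1%N; have [fj|fj] := eqVneq (f j) 1%N.
- have [Ji gi] := no_point fi; have [Jj gj] := no_point fj.
  rewrite ri rj fi fj in gi gj ker wi wj.
  apply: (has_row_ordered (t := [::]) pm _ ker) => /=; first by rewrite Ji Jj.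
  rewrite /row_on /= wi wj muln1 gi gj; exact: RowD8.
- have [Ji gi] := no_point fi; have [z [Jj wz gj]] := one_point fj rj.
  rewrite ri fi in gi ker' wi.
  apply: (has_row_ordered (t := [:: z]) pm' _ ker') => /=; first by rewrite Ji Jj.
  rewrite /row_on /= wi wj wz muln1 gi gj; apply: RowD7 => //; lia.
- have [Jj gj] := no_point fj; have [z [Ji wz gi]] := one_point fi ri.
  rewrite rj fj in gj ker wj.
  apply: (has_row_ordered (t := [:: z]) pm _ ker) => /=; first by rewrite Ji Jj.
  rewrite /row_on /= wi wj wz muln1 gi gj; apply: RowD7 => //; lia.
have [z [Ji wz gi]] := one_point fi ri; have [z' [Jj wz' gj]] := one_point fj rj.
apply: (has_row_ordered (t := [:: z; z']) pm _ ker) => /=; first by rewrite Ji Jj.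
rewrite /row_on /= wi wj wz wz' gi gj; apply: RowD6 => //; lia.
Qed.

Lemma row_T1 i j k l : perm_eq [:: i; j; k; l] (enum 'I_(size p)) ->
  cyclic_ramification e N i j -> (forall m : 'I_(size p), weight p m = 2%N) ->
  has_row Tubular pi.
Proof.
move=> pm cyc w2; have [ei ej ri rj] := cyclic_ramified cyc.
have [NE fi] := @mul_prime 2 _ isT (etrans (esym (w2 i)) ei).
have [_ fj] := @mul_prime 2 _ isT (etrans (esym (w2 j)) ej).
have u : uniq [:: i; j; k; l] by rewrite (perm_uniq pm) enum_uniq.
have [|fk rk] := @cyclic_unramified i j k cyc.
  exact: (subseq_uniq (mask_subseq [:: true; true; true; false] [:: i; j; k; l])).
have [|fl rl] := @cyclic_unramified i j l cyc.
  exact: (subseq_uniq (mask_subseq [:: true; true; false; true] [:: i; j; k; l])).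
have [_ ker] := cyclic_kernel wp wq st cyc; rewrite fi fj in ker.
have [Ji gi] := no_point fi; rewrite ri in gi.
have [Jj gj] := no_point fj; rewrite rj in gj.
have [||z1 [z2 [Jk [w1 w1'] gk]]] := @two_points k; rewrite ?fk ?w2 ?rk //.
have [||z3 [z4 [Jl [w3 w3'] gl]]] := @two_points l; rewrite ?fl ?w2 ?rl //.
apply: (has_row_ordered (t := [:: z1; z2; z3; z4]) pm _ ker) => /=.
  by rewrite Ji Jj Jk Jl; perm_list.
rewrite /row_on /= w1 w1' w3 w3' gi gj gk gl fk fl !w2.
exact: RowT1.
Qed.

Lemma row_D4 i j k : perm_eq [:: i; j; k] (enum 'I_(size p)) ->
  klein_ramification e N i j k ->
  weight p i = 2%N -> weight p j = 2%N -> has_row Domestic pi.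
Proof.
move=> pm kl wi wj; have [[ei ej ek] [ri rj rk]] := klein_ramified kl.
have [fi fj] : f i = 1%N /\ f j = 1%N by move: ei ej; rewrite wi wj; lia.
have [_ ker] := klein_kernel wp wq st kl; rewrite fi fj in ker.
have [Ji gi] := no_point fi; rewrite ri in gi.
have [Jj gj] := no_point fj; rewrite rj in gj.
have f0 := std_f_gt0 wp st k.
have [fk|fk] := eqVneq (f k) 1%N.
  have [Jk gk] := no_point fk; rewrite rk in gk; rewrite fk in ker ek.
  apply: (has_row_ordered (t := [::]) pm _ ker) => /=; first by rewrite Ji Jj Jk.
  rewrite /row_on /= wi wj ek gi gj gk.
  have := @RowD4 _ _ (gen i) (gen j) (gen k) (can_elt p)
    (can_elt q) (can_elt q) (can_elt q) (can_elt q) (can_elt q) 1 isT.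
  by rewrite /drop_ones /= -[can_elt q + can_elt q]mulr2n.
have [z1 [z2 [Jk [w1 w2] gk]]] := two_points fk rk.
apply: (has_row_ordered (t := [:: z1; z2]) pm _ ker) => /=.
  by rewrite Ji Jj Jk; perm_list.
rewrite /row_on /= wi wj ek w1 w2 gi gj gk.
have := @RowD4 _ _ (gen i) (gen j) (gen k) (can_elt p)
  (gen z1) (gen z2) (can_elt q) (can_elt q) (can_elt q) (f k) f0.
by rewrite /drop_ones /= fk.
Qed.

Lemma row_T2 i j k l : perm_eq [:: i; j; k; l] (enum 'I_(size p)) ->
  klein_ramification e N i j k -> (forall m : 'I_(size p), weight p m = 2%N) ->
  has_row Tubular pi.
Proof.
move=> pm kl w2; have [[ei ej ek] [ri rj rk]] := klein_ramified kl.
have [fi fj fk] : [/\ f i = 1, f j = 1 & f k = 1]%N by move: ei ej ek; rewrite !w2; split; lia.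
have u : uniq [:: i; j; k; l] by rewrite (perm_uniq pm) enum_uniq.
have el : e l = 1%N.
  have [_ _ ->] := kl; case: ifP => // lin; move: u.
  by rewrite -[[:: i; j; k; l]]/([:: i; j; k] ++ [:: l]) cat_uniq /= lin andbF.
have [fl rl] : f l = 2%N /\ r l = 4%N.
  by have := std_weight st l; have := std_order st l; rewrite w2 el; have [-> _ _] := kl; lia.
have [_ ker] := klein_kernel wp wq st kl; rewrite fi fj fk in ker.
have [Ji gi] := no_point fi; rewrite ri in gi.
have [Jj gj] := no_point fj; rewrite rj in gj.
have [Jk gk] := no_point fk; rewrite rk in gk.
have [||z1 [z2 [z3 [z4 [Jl [w1 w1' w3 w3'] gl]]]]] := @four_points l; rewrite ?fl ?rl //.
apply: (has_row_ordered (t := [:: z1; z2; z3; z4]) pm _ ker) => /=.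
  by rewrite Ji Jj Jk Jl; perm_list.
rewrite /row_on /= w1 w1' w3 w3' gi gj gk gl fl !w2.
exact: RowT2.
Qed.

Lemma row_T6 i j k : perm_eq [:: i; j; k] (enum 'I_(size p)) ->
  klein_ramification e N i j k ->
  weight p i = 4%N -> weight p j = 4%N -> weight p k = 2%N -> has_row Tubular pi.
Proof.
move=> pm kl wi wj wk; have [[ei ej ek] [ri rj rk]] := klein_ramified kl.
have [fi fj fk] : [/\ f i = 2, f j = 2 & f k = 1]%N.
  by move: ei ej ek; rewrite wi wj wk; split; lia.
have [_ ker] := klein_kernel wp wq st kl; rewrite fi fj fk in ker.
have [Jk gk] := no_point fk; rewrite rk in gk.
have [|z1 [z2 [Ji [w1 w2] gi]]] := two_points _ ri; first by rewrite fi.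
have [|z3 [z4 [Jj [w3 w4] gj]]] := two_points _ rj; first by rewrite fj.
apply: (has_row_ordered (t := [:: z1; z2; z3; z4]) pm _ ker) => /=.
  by rewrite Ji Jj Jk; perm_list.
rewrite /row_on /= wi wj wk w1 w2 w3 w4 gi gj gk fi fj.
exact: RowT6.
Qed.

Lemma coprime_unramified i j k : cyclic3 e N i j k ->
  coprime (weight p i) (weight p j) -> False.
Proof.
move=> c3; have [[-> -> _] _] := cyclic3P c3; move: N1.
rewrite /coprime -muln_gcdr muln_eq1 => N2 /andP[/eqP NE _].
by rewrite NE in N2.
Qed.

(** Two ramified weights have the common divisor N > 1; this leaves few pairs. *)
Lemma cyclic_has_row T i j : has_type T p -> cyclic_ramification e N i j ->
  has_row T pi.
Proof.
move=> [P pP stP] cyc; have [s ps sP] := enum_by_weights pP.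
have cases := cyclic3_cases _ cyc.
case: T P / stP sP {pP} => [|a _|a b _ _|a a2| | | | | | |];
  case: s ps => [|x [|y [|z [|t []]]]] //= ps.
- by have := mem_enum 'I_(size p) i; rewrite -(perm_mem ps).
- move=> _; have := cyc.1.
  by have := mem_enum 'I_(size p) i; have := mem_enum 'I_(size p) j;
     rewrite -!(perm_mem ps) !inE => /eqP-> /eqP->; rewrite eqxx.
- move=> _; apply: (row_D6_D7_D8 _ cyc).
  have [|s' ps'] := @complete_enum _ [:: i; j]; first by rewrite /= inE cyc.1.
  have := perm_size ps'; rewrite -(perm_size ps).
  by case: s' ps'.
- case=> wx wy wz; case: (cases _ _ _ ps) => c3.
  + exact: (row_D5 c3).
  + by apply: (row_D3 c3).
  + by apply: (row_D3 c3).
- case=> wx wy wz; case: (cases _ _ _ ps) => c3.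
  + by have := coprime_unramified c3; rewrite wx wy => /(_ isT).
  + by have := coprime_unramified c3; rewrite wx wz => /(_ isT).
  + by apply: (row_D2 c3).
- case=> wx wy wz; case: (cases _ _ _ ps) => c3.
  + by have := coprime_unramified c3; rewrite wx wy => /(_ isT).
  + by apply: (row_D1 c3).
  + by have := coprime_unramified c3; rewrite wy wz => /(_ isT).
- case=> wx wy wz; case: (cases _ _ _ ps) => c3.
  + by have := coprime_unramified c3; rewrite wx wy => /(_ isT).
  + by have := coprime_unramified c3; rewrite wx wz => /(_ isT).
  + by have := coprime_unramified c3; rewrite wy wz => /(_ isT).
- case=> wx wy wz wt.
  have w2 m : weight p (m : 'I_(size p)) = 2%N.
    by have := mem_enum 'I_(size p) m; rewrite -(perm_mem ps) !inE => /or4P[]/eqP->.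
  have [|s' ps'] := @complete_enum _ [:: i; j]; first by rewrite /= inE cyc.1.
  have := perm_size ps'; rewrite -(perm_size ps).
  case: s' ps' => [|k [|l []]] //= ps' _.
  exact: (row_T1 ps' cyc w2).
- case=> wx wy wz; case: (cases _ _ _ ps) => c3; by apply: (row_T7 c3).
- case=> wx wy wz; case: (cases _ _ _ ps) => c3.
  + by apply: (row_T4_T5 c3).
  + by apply: (row_T3 c3).
  + by apply: (row_T3 c3).
- case=> wx wy wz; case: (cases _ _ _ ps) => c3.
  + by apply: (row_T9 c3).
  + by apply: (row_T8 c3).
  + by have := coprime_unramified c3; rewrite wy wz => /(_ isT).
Qed.

Lemma klein_even i j k l : klein_ramification e N i j k -> l \in [:: i; j; k] ->
  ~~ odd (weight p l).
Proof.
by move=> [_ _ eE] lin; rewrite (std_weight st) eE lin oddM.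
Qed.

Lemma klein_has_row T i j k : has_type T p -> klein_ramification e N i j k ->
  has_row T pi.
Proof.
move=> [P pP stP] kl; have [s ps sP] := enum_by_weights pP.
have sz : (2 < size s)%N.
  have [_ u _] := kl; have [s' ps'] := complete_enum u.
  by rewrite (perm_size ps) -(perm_size ps') size_cat.
case: T P / stP sP {pP} => [|a _|a b _ _|a a2| | | | | | |];
  case: s ps sz => [|x [|y [|z [|t []]]]] //= ps _.
- case=> wx wy wz; exact: (row_D4 ps (klein_reorder ps kl)).
- case=> wx wy wz; have := klein_even (klein_reorder ps kl) (l := y).
  by rewrite wy !inE eqxx orbT => /(_ isT).
- case=> wx wy wz; have := klein_even (klein_reorder ps kl) (l := y).
  by rewrite wy !inE eqxx orbT => /(_ isT).
- case=> wx wy wz; have := klein_even (klein_reorder ps kl) (l := y).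
  by rewrite wy !inE eqxx orbT => /(_ isT).
- case=> wx wy wz wt.
  have w2 m : weight p (m : 'I_(size p)) = 2%N.
    by have := mem_enum 'I_(size p) m; rewrite -(perm_mem ps) !inE => /or4P[]/eqP->.
  have [_ u _] := kl; have [s' ps'] := complete_enum u.
  have := perm_size ps'; rewrite -(perm_size ps).
  case: s' ps' => [|l []] //= ps' _.
  exact: (row_T2 ps' kl w2).
- case=> wx wy wz; have := klein_even (klein_reorder ps kl) (l := y).
  by rewrite wy !inE eqxx orbT => /(_ isT).
- case=> wx wy wz; exact: (row_T6 ps (klein_reorder ps kl)).
- case=> wx wy wz; have := klein_even (klein_reorder ps kl) (l := y).
  by rewrite wy !inE eqxx orbT => /(_ isT).
Qed.

End Matching.

Lemma has_type_weights (T : weight_type) (p : seq nat) :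
  has_type T p -> weight_sequence p.
Proof.
move=> [P pP]; rewrite /weight_sequence (perm_all _ pP).
by case=> /= [|a ->|a b -> ->|a ->| | | | | | |].
Qed.

Theorem theoremB :
  (forall (T : weight_type) (p q : seq nat)
      (pi : {additive string_group p -> string_group q}),
    has_type T p -> has_type T q ->
    admissible pi -> (exists2 x, x != 0 & pi x = 0) ->
    exists (xs : seq (nat * string_group p)) (zs : seq (nat * string_group q))
           (K : seq (string_group p)),
      [/\ perm_eq xs (weighted_gens p), perm_eq zs (weighted_gens q),
          row_on (unzip2 xs) (can_elt p) (unzip2 zs) (can_elt q)
            T (unzip1 xs) (unzip1 zs) K (map pi (unzip2 xs))
        & kernel_generated_by pi K])
  /\
  (forall (T : weight_type) (p q : seq nat)
      (K : seq (string_group p)) (y : seq (string_group q)),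
    row_on (gens p) (can_elt p) (gens q) (can_elt q) T p q K y ->
    exists pi : {additive string_group p -> string_group q},
      [/\ map pi (gens p) = y,
          forall pi' : {additive string_group p -> string_group q},
            map pi' (gens p) = y -> pi' =1 pi,
          admissible pi
        & kernel_generated_by pi K]).
Proof.
split=> [T p q pi tp tq adm ker|T p q K y]; last exact: row_realised.
have [wp wq] := (has_type_weights tp, has_type_weights tq).
have [f [e [r [N [J [st N1]]]]]] := admissible_standard wp wq adm ker.
case=> [[i [j cyc]]|[i [j [k kl]]]].
  exact: (cyclic_has_row wp wq st N1 tp cyc).
exact: (klein_has_row wp wq st N1 tp kl).
Qed.
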